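(* Assume the setting of the context: the parameter conditions and the regularity assumption hold, $r\in(0,r_0)$, $(\vec\xi,\varphi)$ is a solution of the continuous problem with $(u,\varphi)\in W_r$, and, for each $h$, $(\vec\xi_h,\varphi_h)$ is a solution of the discrete problem with $(u_h,\varphi_h)\in W_r^h$. Assume that $r$ and the data $\alpha,g$ are sufficiently small so that $$ r\,\frac{c_1(\Omega)}{\widetilde\alpha}\le\frac12\qquad\text{and}\qquad C_1\,|\alpha|\,|g|\le\frac12,\qquad\text{where } C_1:=C_{ST}\big(1+r\,\widehat C(r)+r\,C_{\mathcal A}\big).$$ Then there exists a positive constant $C^*$, independent of $h$, such that $$\|\vec\xi-\vec\xi_h\|_{\mathbb H}+\|\varphi-\varphi_h\|_{1,\Omega}\ \le\ C^*\Big\{\mathrm{dist}(\vec\xi,\mathbb H_h)+\|\varphi-\mathcal I_h^{SZ}(\varphi)\|_{1,\Omega}\Big\},$$ where $\mathrm{dist}(\vec\xi,\mathbb H_h)=\inf_{\vec\eta_h\in\mathbb H_h}\|\vec\xi-\vec\eta_h\|_{\mathbb H}$.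
   Context: Domain and notation. $n\in\{2,3\}$; $\Omega\subset\mathbb R^n$ is a bounded domain with polygonal/polyhedral boundary $\Gamma$; $\Gamma_D,\Gamma_N\subseteq\Gamma$, $\Gamma_D\cap\Gamma_N=\varnothing$, $|\Gamma_D|>0$, $\Gamma=\overline\Gamma_D\cup\overline\Gamma_N$. $\|\cdot\|_{s,\Omega}$, $|\cdot|_{s,\Omega}$ are the norm and seminorm of $H^s(\Omega)$ (also for vectors/tensors). $(\nabla v)_{ij}=\partial v_i/\partial x_j$, $e(v)=\frac12(\nabla v+(\nabla v)^{\mathrm t})$, $\omega(v)=\frac12(\nabla v-(\nabla v)^{\mathrm t})$, $(v\otimes w)_{ij}=v_iw_j$, $\tau^{\mathrm d}=\tau-\frac1n\mathrm{tr}(\tau)\mathbb I$, $\mathbf{div}$ is the row-wise divergence, $\|\tau\|_{\mathbf{div},\Omega}^2=\|\tau\|_{0,\Omega}^2+\|\mathbf{div}\,\tau\|_{0,\Omega}^2$. Spaces. $\mathbb L^2_{\mathrm{tr}}(\Omega)=\{r\in[L^2(\Omega)]^{n\times n}: r^{\mathrm t}=r,\ \mathrm{tr}\,r=0\}$; $\mathbb H_0(\mathbf{div};\Omega)=\{\tau\in[L^2(\Omega)]^{n\times n}:\mathbf{div}\,\tau\in[L^2(\Omega)]^n,\ \int_\Omega\mathrm{tr}\,\tau=0\}$; $\mathbf H_0^1(\Omega)=[H_0^1(\Omega)]^n$; $\mathbf H^1_{\Gamma_D}(\Omega)=\{\psi\in[H^1(\Omega)]^n:\psi|_{\Gamma_D}=0\}$;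 $\mathbb H=\mathbb L^2_{\mathrm{tr}}(\Omega)\times\mathbb H_0(\mathbf{div};\Omega)\times\mathbf H^1_0(\Omega)$ with $\|(r,\tau,v)\|_{\mathbb H}^2=\|r\|_{0,\Omega}^2+\|\tau\|_{\mathbf{div},\Omega}^2+\|v\|_{1,\Omega}^2$; $\mathbf H=\mathbf H_0^1(\Omega)\times[H^1(\Omega)]^n$ with $\|(w,\phi)\|_{\mathbf H}=\|w\|_{1,\Omega}+\|\phi\|_{1,\Omega}$; $W_r=\{(w,\phi)\in\mathbf H:\|(w,\phi)\|_{\mathbf H}\le r\}$. Data. $\gamma>0$; constant vectors $\alpha,g\in\mathbb R^n$; a diagonal $\mathbb K\in[L^\infty(\Omega)]^{n\times n}$ with $(\mathbb Kx)\cdot x\ge k_0|x|^2$ for all $x\in\mathbb R^n$, $k_0>0$; $\nu:\mathbb R^2\to\mathbb R$ with $0<\nu_1\le\nu\le\nu_2$ and Lipschitz with constant $L_\nu$, where $\nu(\phi):=\nu(\phi_1,\phi_2)$ for a vector function $\phi$; $\varphi_D\in[H^{1/2}(\Gamma_D)]^n$, with $\|\varphi_D\|_{1/2,\Gamma_D}=\inf\{\|\chi\|_{1,\Omega}:\chi\in[H^1(\Omega)]^n,\chi|_{\Gamma_D}=\varphi_D\}$; $E(\varphi_D)\in[H^1(\Omega)]^n$ is the unique extension of $\varphi_D$ attaining this infimum. Forms. For $\phi\in[H^1(\Omega)]^n$, $w\in\mathbf H_0^1(\Omega)$, $\vec\xi=(t,\sigma,u)$, $\vec\eta=(r,\tau,v)$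 in $\mathbb H$: $$\begin{aligned}\mathbf A_\phi(\vec\xi,\vec\eta)=&\,2\int_\Omega\nu(\phi)t:\{r-\kappa_3\tau^{\mathrm d}\}+\int_\Omega t:\{\tau^{\mathrm d}-\kappa_1e(v)\}-\int_\Omega\sigma^{\mathrm d}:\{r-\kappa_3\tau^{\mathrm d}\}+(1-\kappa_2\gamma)\int_\Omega u\cdot\mathbf{div}\,\tau\\&-\int_\Omega v\cdot\mathbf{div}\,\sigma+\int_\Omega\omega(u):\tau-\int_\Omega\sigma:\omega(v)+\gamma\int_\Omega u\cdot v+\kappa_2\int_\Omega\mathbf{div}\,\sigma\cdot\mathbf{div}\,\tau+\kappa_1\int_\Omega e(u):e(v),\end{aligned}$$ $\mathbf B_w(\vec\xi,\vec\eta)=\int_\Omega(u\otimes w)^{\mathrm d}:\{\kappa_3\tau^{\mathrm d}-r\}$, $F_\phi(\vec\eta)=\int_\Omega(\alpha\cdot\phi)\,g\cdot\{v-\kappa_2\mathbf{div}\,\tau\}$, $\mathbf C(\chi,\psi)=\int_\Omega\mathbb K\nabla\chi:\nabla\psi$, $G_{w,\phi}(\psi)=-\int_\Omega(\nabla\phi)w\cdot\psi$. Parameter conditions. $\delta_1\in(0,1/\nu_2)$, $\delta_2\in(0,2/\gamma)$, $\delta_3\in(0,1)$, $\kappa_3\in(0,2\nu_1\delta_1/\nu_2)$, $\kappa_2\in(0,2\delta_2)$, $\kappa_1\in\big(0,2\delta_3(2\nu_1-\kappa_3\nu_2/\delta_1)\big)$. Continuous problem. Find $(\vec\xi,\varphi)\in\mathbb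 H\times[H^1(\Omega)]^n$, $\vec\xi=(t,\sigma,u)$, with $\varphi|_{\Gamma_D}=\varphi_D$, such that $\mathbf A_\varphi(\vec\xi,\vec\eta)+\mathbf B_u(\vec\xi,\vec\eta)=F_\varphi(\vec\eta)$ for all $\vec\eta\in\mathbb H$ and $\mathbf C(\varphi,\psi)=G_{u,\varphi}(\psi)$ for all $\psi\in\mathbf H^1_{\Gamma_D}(\Omega)$. Discrete spaces. $\{\mathcal T_h\}_{h>0}$ is a regular family of triangulations of $\Omega$ by triangles/tetrahedra $K$, $h=\max_K h_K$, with every boundary edge/face contained in $\overline\Gamma_D$ or $\overline\Gamma_N$; $k\ge0$ is an integer; $\mathbf{RT}_k(K)=[P_k(K)]^n\oplus P_k(K)x$. $\mathbb H_h^t=\{r_h\in\mathbb L^2_{\mathrm{tr}}(\Omega): r_h|_K\in[P_k(K)]^{n\times n}\ \forall K\}$; $\mathbf H_h^\sigma=\{\tau_h\in\mathbb H_0(\mathbf{div};\Omega):$ each row of $\tau_h|_K$ lies in $\mathbf{RT}_k(K)\ \forall K\}$; $\mathbf H_h^u=\{v_h\in[C(\overline\Omega)]^n: v_h|_K\in[P_{k+1}(K)]^n\ \forall K,\ v_h=0\text{ on }\Gamma\}$; $\mathbf H_h^\varphi=\{\psi_h\in[C(\overline\Omega)]^n:\psi_h|_K\in[P_{k+1}(K)]^n\ \forall K\}$; $\mathbf H^\varphi_{h,\Gamma_D}=\{\psi_h\in\mathbf H_h^\varphi:\psi_h|_{\Gamma_D}=0\}$; $\mathbb H_h=\mathbb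 H_h^t\times\mathbf H_h^\sigma\times\mathbf H_h^u$; $\mathbf H_h=\mathbf H_h^u\times\mathbf H_h^\varphi$; $W_r^h=\{(w_h,\phi_h)\in\mathbf H_h:\|(w_h,\phi_h)\|_{\mathbf H}\le r\}$. $\mathcal I_h^{SZ}:[H^1(\Omega)]^n\to\mathbf H_h^\varphi$ is the Scott–Zhang interpolation operator of degree $k+1$ (chosen so that $\mathcal I_h^{SZ}(v)|_{\Gamma_D}$ depends only on $v|_{\Gamma_D}$), and $\varphi_{D,h}:=\mathcal I_h^{SZ}(E(\varphi_D))|_{\Gamma_D}$. Discrete problem. Find $(\vec\xi_h,\varphi_h)\in\mathbb H_h\times\mathbf H_h^\varphi$, $\vec\xi_h=(t_h,\sigma_h,u_h)$, with $\varphi_h|_{\Gamma_D}=\varphi_{D,h}$, such that $\mathbf A_{\varphi_h}(\vec\xi_h,\vec\eta_h)+\mathbf B_{u_h}(\vec\xi_h,\vec\eta_h)=F_{\varphi_h}(\vec\eta_h)$ for all $\vec\eta_h\in\mathbb H_h$ and $\mathbf C(\varphi_h,\psi_h)=G_{u_h,\varphi_h}(\psi_h)$ for all $\psi_h\in\mathbf H^\varphi_{h,\Gamma_D}$. Constants. $c_1(\Omega)=\|i\|^2$ with $i:[H^1(\Omega)]^n\to[L^4(\Omega)]^n$ the Sobolev embedding; $\alpha(\Omega)>0$ is a constant with $\mathbf A_\phi(\vec\xi,\vec\xi)\ge\alpha(\Omega)\|\vec\xi\|_{\mathbb H}^2$ for all $\vec\xi\in\mathbb H$ and $\phi\in[H^1(\Omega)]^n$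 (it exists under the parameter conditions); $r_0=\alpha(\Omega)/(2c_1(\Omega)(2+\kappa_3^2)^{1/2})$; $C_{\mathcal A}=2\sqrt2(2+\kappa_2^2)^{1/2}/\alpha(\Omega)$; $c_{\rm gp}$ is the Poincaré constant, $\|\psi\|_{1,\Omega}\le c_{\rm gp}|\psi|_{1,\Omega}$ on $\mathbf H^1_{\Gamma_D}(\Omega)$; $\widetilde\alpha=k_0c_{\rm gp}^{-2}$. For $(w,\phi)\in\mathbf H$ with $\|w\|_{1,\Omega}<r_0$, $\mathcal A(w,\phi)\in\mathbb H$ denotes the unique $\vec\xi$ with $\mathbf A_\phi(\vec\xi,\vec\eta)+\mathbf B_w(\vec\xi,\vec\eta)=F_\phi(\vec\eta)$ for all $\vec\eta\in\mathbb H$. Regularity assumption. For some $\varepsilon\in(0,1)$ if $n=2$, or $\varepsilon\in[\frac12,1)$ if $n=3$, every $(w,\phi)\in\mathbf H$ with $\|w\|_{1,\Omega}+\|\phi\|_{1,\Omega}\le r$ is such that $(\bar r,\bar\tau,\bar v)=\mathcal A(w,\phi)$ satisfies $\bar r,\bar\tau\in[H^\varepsilon(\Omega)]^{n\times n}$, $\bar v\in[H^{1+\varepsilon}(\Omega)]^n$ and $\|\bar r\|_{\varepsilon,\Omega}+\|\bar\tau\|_{\varepsilon,\Omega}+\|\bar v\|_{1+\varepsilon,\Omega}\le\widehat C(r)|\alpha||g|\|\phi\|_{0,\Omega}$, with $\widehat C(r)>0$ independent of $(w,\phi)$. $C_{ST}>0$ is a constant independent of $h$ (depending only on $\alpha(\Omega)$,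 $L_\nu$, $c_1(\Omega)$, $\kappa_1,\kappa_2,\kappa_3$, $\nu_2$, $\gamma$, $r$ and on the norms of the embeddings $H^\varepsilon(\Omega)\to L^{2n/(n-2\varepsilon)}(\Omega)$ and $H^1(\Omega)\to L^{n/\varepsilon}(\Omega)$) such that, for every $h$, $$\|\vec\xi-\vec\xi_h\|_{\mathbb H}\le C_{ST}\big\{\mathrm{dist}(\vec\xi,\mathbb H_h)+|\alpha||g|\|\varphi-\varphi_h\|_{1,\Omega}+\|t\|_{\varepsilon,\Omega}\|\varphi-\varphi_h\|_{1,\Omega}+\|u\|_{1,\Omega}\|u-u_h\|_{1,\Omega}\big\};$$ such a constant exists. *)

(* Defs.v *)
From HB Require Import structures.
From mathcomp Require Import all_boot all_order all_algebra.
From mathcomp Require Import all_classical all_reals all_analysis.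
Import Order.TTheory GRing.Theory Num.Theory.
Import numFieldNormedType.Exports.

Set Implicit Arguments.
Unset Strict Implicit.
Unset Printing Implicit Defensive.

Local Open Scope classical_set_scope.
Local Open Scope ring_scope.

(* Points and vectors of R^n are columns 'cV[R]_n, tensors are 'M[R]_n. The   *)
(* library norm on matrices is the sup norm, used only for the topology;      *)
(* integrands and distances use the Euclidean and Frobenius norms.            *)
Section algebra.
Context {R : realType} {n : nat}.

Definition dotv (u v : 'cV[R]_n) : R := \sum_i u i ord0 * v i ord0.
Definition ddot (A B : 'M[R]_n) : R := \sum_i \sum_j A i j * B i j.
Definition enorm (v : 'cV[R]_n) : R := Num.sqrt (dotv v v).

Definition dev (A : 'M[R]_n) : 'M[R]_n := A - (n%:R^-1 * \tr A)%:M.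
Definition symm (A : 'M[R]_n) : 'M[R]_n := 2^-1 *: (A + A^T).
Definition skew (A : 'M[R]_n) : 'M[R]_n := 2^-1 *: (A - A^T).
Definition tensor (v w : 'cV[R]_n) : 'M[R]_n := v *m w^T.

(* (i+1)-st component of v, 0 if i >= n                                       *)
Definition vcomp (v : 'cV[R]_n) (i : nat) : R := \sum_(j < n | j == i :> nat) v j ord0.

End algebra.

(* Method II construction of outer measures: covers by sets of diameter at    *)
(* most delta, then delta -> 0.                                               *)
Definition allsets (T : Type) : Type := T.

Section allsets.
Variable T : pointedType.
HB.instance Definition _ := Pointed.on (allsets T).
HB.instance Definition _ := @isMeasurable.Build default_measure_display
  (allsets T) (@discrete_measurable (allsets T)) (@discrete_measurable0 _)
  (@discrete_measurableC _) (@discrete_measurableU _).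
End allsets.

Section method_II.
Context {R : realType} {n : nat}.
Local Open Scope ereal_scope.

Definition ediam (A : set 'cV[R]_n) : \bar R :=
  ereal_sup ([set 0] `|` [set (enorm (x - y))%:E | x in A & y in A]).

Variable zeta : set 'cV[R]_n -> \bar R.

Definition gauge_le (delta : R) (A : set (allsets 'cV[R]_n)) : \bar R :=
  if `[< A = set0 >] then 0
  else if ediam A <= delta%:E then zeta A else +oo.

Definition methodII (A : set 'cV[R]_n) : \bar R :=
  ereal_sup [set mu_ext (gauge_le delta) A | delta in [set d : R | (0 < d)%R]].

Hypothesis zeta_ge0 : forall A, 0 <= zeta A.

Let gauge0 delta : gauge_le delta set0 = 0.
Proof. by rewrite /gauge_le; case: asboolP. Qed.

Let gauge_ge0 delta A : 0 <= gauge_le delta A.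
Proof. by rewrite /gauge_le; case: asboolP => // _; case: ifP. Qed.

Lemma methodII_ge0 A : 0 <= methodII A.
Proof.
apply: (@le_trans _ _ (mu_ext (gauge_le 1) A)); first exact: mu_ext_ge0.
by apply: ereal_sup_ubound; exists 1%R => //=.
Qed.

Lemma methodII0 : methodII set0 = 0.
Proof.
apply/eqP; rewrite eq_le methodII_ge0 andbT.
by apply: ge_ereal_sup => _ [d _ <-]; rewrite mu_ext0.
Qed.

Lemma le_methodII : {homo methodII : A B / A `<=` B >-> A <= B}.
Proof.
move=> A B AB; apply: ge_ereal_sup => _ [d d0 <-].
apply: (@le_trans _ _ (mu_ext (gauge_le d) B)); first exact: le_mu_ext.
by apply: ereal_sup_ubound; exists d.
Qed.

Lemma methodII_sigma_subadditive : sigma_subadditive methodII.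
Proof.
move=> A; apply: ge_ereal_sup => _ [d d0 <-].
apply: (le_trans (mu_ext_sigma_subadditive (gauge_ge0 d) A)).
apply: lee_nneseries => k *; first exact: mu_ext_ge0.
by apply: ereal_sup_ubound; exists d.
Qed.

End method_II.

Section measures.
Context {R : realType} {n : nat}.
Local Open Scope ereal_scope.

(* volume of the smallest box with sides parallel to the axes around A        *)
Definition width (A : set 'cV[R]_n) (i : 'I_n) : \bar R :=
  ereal_sup ([set 0] `|` [set `|x i ord0 - y i ord0|%:E | x in A & y in A]).
Definition boxvol (A : set 'cV[R]_n) : \bar R := \big[mule/1]_(i < n) width A i.

(* no normalizing constant: no statement below depends on it                  *)
Definition diampow (A : set 'cV[R]_n) : \bar R := ediam A ^+ n.-1.

Let boxvol_ge0 A : 0 <= boxvol A.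
Proof.
rewrite /boxvol; elim/big_ind : _ => // [x y|i _]; first exact: mule_ge0.
by apply: ereal_sup_ubound; left.
Qed.

Let diampow_ge0 A : 0 <= diampow A.
Proof. by apply: expe_ge0; apply: ereal_sup_ubound; left. Qed.

(* Lebesgue outer measure of R^n (boxes can be cut into boxes of diameter at  *)
(* most delta) and (n-1)-dimensional Hausdorff outer measure                  *)
Definition leb_outer : set 'cV[R]_n -> \bar R := methodII boxvol.
Definition surf_outer : set 'cV[R]_n -> \bar R := methodII diampow.

HB.instance Definition _ := isOuterMeasure.Build R 'cV[R]_n leb_outer
  (methodII0 boxvol_ge0) (methodII_ge0 boxvol_ge0) (@le_methodII _ _ _)
  (methodII_sigma_subadditive boxvol_ge0).
HB.instance Definition _ := isOuterMeasure.Build R 'cV[R]_n surf_outer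
  (methodII0 diampow_ge0) (methodII_ge0 diampow_ge0) (@le_methodII _ _ _)
  (methodII_sigma_subadditive diampow_ge0).

Definition leb_om : {outer_measure set 'cV[R]_n -> \bar R} := leb_outer.
Definition surf_om : {outer_measure set 'cV[R]_n -> \bar R} := surf_outer.

Definition leb : {measure set (caratheodory_type leb_om) -> \bar R} :=
  (leb_om : set (caratheodory_type leb_om) -> \bar R).
Definition surf : {measure set (caratheodory_type surf_om) -> \bar R} :=
  (surf_om : set (caratheodory_type surf_om) -> \bar R).

End measures.

Notation vfield R n := ('cV[R]_n -> 'cV[R]_n).
Notation tfield R n := ('cV[R]_n -> 'M[R]_n).
(* An element of [H^1]^n is a pair (v, grad v), an element of H(div) a pair   *)
(* (tau, div tau); the membership predicates below say that the second field  *)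
(* is the weak gradient (divergence) of the first one. Elements are           *)
(* representatives of L^2 classes.                                            *)
Notation h1field R n := (vfield R n * tfield R n)%type.
Notation dfield R n := (tfield R n * vfield R n)%type.
(* ((t, (sigma, div sigma)), (u, grad u))                                     *)
Notation state R n := ((tfield R n * dfield R n) * h1field R n)%type.
Notation simplex R m n := {ffun 'I_m -> 'cV[R]_n}.

Section sobolev.
Context {R : realType} {n : nat}.
Variable Om : set 'cV[R]_n.

Definition bdry : set 'cV[R]_n := closure Om `\` Om.

Definition intO (f : 'cV[R]_n -> R) : R := \int[leb]_(x in Om) f x.

Definition L2 (f : 'cV[R]_n -> R) :=
  measurable_fun (Om : set (caratheodory_type leb_om)) f /\
  (\int[leb]_(x in Om) (f x ^+ 2)%:E < +oo)%E.
Definition L2v (v : vfield R n) := forall i, L2 (fun x => v x i ord0).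
Definition L2t (tau : tfield R n) := forall i j, L2 (fun x => tau x i j).

Definition sqv (v : vfield R n) : \bar R :=
  (\int[leb]_(x in Om) (dotv (v x) (v x))%:E)%E.
Definition sqt (tau : tfield R n) : \bar R :=
  (\int[leb]_(x in Om) (ddot (tau x) (tau x))%:E)%E.

Definition partial (j : 'I_n) (f : 'cV[R]_n -> R) : 'cV[R]_n -> R :=
  fun x => 'D_(delta_mx j ord0) f x.
Definition smooth (f : 'cV[R]_n -> R) :=
  forall s : seq 'I_n, let g := foldr partial f s in
  continuous g /\ forall x j, derivable g x (delta_mx j ord0).
Definition smoothv (v : vfield R n) := forall i, smooth (fun x => v x i ord0).
Definition cgrad (v : vfield R n) : tfield R n :=
  fun x => \matrix_(i, j) partial j (fun y => v y i ord0) x.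
Definition test (f : 'cV[R]_n -> R) :=
  [/\ smooth f, compact (closure [set x | f x != 0])
    & closure [set x | f x != 0] `<=` Om].

Definition H1 : set (h1field R n) := [set p | [/\ L2v p.1, L2t p.2 &
  forall f i j, test f ->
    intO (fun x => p.1 x i ord0 * partial j f x) = - intO (fun x => p.2 x i j * f x)]].

Definition Hdiv : set (dfield R n) := [set p | [/\ L2t p.1, L2v p.2 &
  forall f i, test f ->
    intO (fun x => \sum_j p.1 x i j * partial j f x)
      = - intO (fun x => p.2 x i ord0 * f x)]].

Definition norm0v (v : vfield R n) : R := Num.sqrt (fine (sqv v)).
Definition norm0t (tau : tfield R n) : R := Num.sqrt (fine (sqt tau)).
Definition norm1 (p : h1field R n) : R :=
  Num.sqrt (norm0v p.1 ^+ 2 + norm0t p.2 ^+ 2).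
Definition normdiv (p : dfield R n) : R :=
  Num.sqrt (norm0t p.1 ^+ 2 + norm0v p.2 ^+ 2).

(* squared H^1 distance to a smooth field                                     *)
Definition sqdist1 (p : h1field R n) (w : vfield R n) : \bar R :=
  (sqv (p.1 - w)%R + sqt (p.2 - cgrad w)%R)%E.

Definition H10 : set (h1field R n) := [set p | H1 p /\
  exists2 w : nat -> vfield R n, (forall m i, test (fun x => w m x i ord0)) &
    (fun m => sqdist1 p (w m)) @ \oo --> 0%E].

(* Gagliardo-Slobodeckij seminorm (squared), 0 < e < 1                        *)
Definition slobo (e : R) (tau : tfield R n) : \bar R :=
  (\int[leb]_(x in Om) \int[leb]_(y in Om)
     (ddot (tau x - tau y) (tau x - tau y)
        / enorm (x - y) `^ (n%:R + 2 * e))%:E)%E.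
Definition Hs (e : R) : set (tfield R n) :=
  [set tau | L2t tau /\ (slobo e tau < +oo)%E].
Definition norms (e : R) (tau : tfield R n) : R :=
  Num.sqrt (norm0t tau ^+ 2 + fine (slobo e tau)).
Definition H1s (e : R) : set (h1field R n) := [set p | H1 p /\ Hs e p.2].
Definition norm1s (e : R) (p : h1field R n) : R :=
  Num.sqrt (norm1 p ^+ 2 + fine (slobo e p.2)).

(* norm of the embedding of [H^1]^n into [L^4]^n; c1 is meaningful only when  *)
(* emb4 is finite                                                             *)
Definition emb4 : \bar R := ereal_sup
  [set ((\int[leb]_(x in Om) (enorm (p.1 x) ^+ 4)%:E) `^ 4^-1)%E
     | p in [set p : h1field R n | H1 p /\ norm1 p <= 1]].
Definition c1 : R := fine emb4 ^+ 2.

(* The trace operator is the continuous extension of the restriction to S of  *)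
(* functions smooth up to the boundary: g is the trace of p on S.             *)
Definition surf_sq (S : set 'cV[R]_n) (g : vfield R n) : \bar R :=
  (\int[surf]_(x in S) (dotv (g x) (g x))%:E)%E.
Definition trace (S : set 'cV[R]_n) (p : h1field R n) (g : vfield R n) :=
  [/\ forall i, measurable_fun (S : set (caratheodory_type surf_om))
                  (fun x => g x i ord0),
      (surf_sq S g < +oo)%E &
      exists2 w : nat -> vfield R n, (forall m, smoothv (w m)) &
        ((fun m => sqdist1 p (w m)) @ \oo --> 0%E) /\
        ((fun m => surf_sq S (w m - g)) @ \oo --> 0%E)].
Definition same_trace (S : set 'cV[R]_n) (p q : h1field R n) :=
  exists2 g, trace S p g & trace S q g.

Definition H1D (GD : set 'cV[R]_n) : set (h1field R n) :=
  [set p | H1 p /\ trace GD p (cst 0)].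

Definition Hhalf (GD : set 'cV[R]_n) : set (vfield R n) :=
  [set g | exists2 p, H1 p & trace GD p g].
Definition norm_half (GD : set 'cV[R]_n) (g : vfield R n) : R :=
  inf [set norm1 p | p in [set p | H1 p /\ trace GD p g]].

Definition L2tr : set (tfield R n) := [set q | L2t q /\
  {ae leb, forall x : 'cV[R]_n, Om x -> (q x)^T = q x /\ \tr (q x) = 0}].
Definition Hdiv0 : set (dfield R n) :=
  [set p | Hdiv p /\ intO (fun x => \tr (p.1 x)) = 0].

Definition HH : set (state R n) :=
  [set xi | [/\ L2tr xi.1.1, Hdiv0 xi.1.2 & H10 xi.2]].
Definition normHH (xi : state R n) : R :=
  Num.sqrt (norm0t xi.1.1 ^+ 2 + normdiv xi.1.2 ^+ 2 + norm1 xi.2 ^+ 2).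
Definition distHH (xi : state R n) (X : set (state R n)) : R :=
  inf [set normHH (xi - eta) | eta in X].

Definition Wball (r : R) (w phi : h1field R n) :=
  [/\ H10 w, H1 phi & norm1 w + norm1 phi <= r].

End sobolev.

Section geometry.
Context {R : realType} {n : nat}.

Definition aff_indep m (a : simplex R m n) := forall l : 'I_m -> R,
  \sum_i l i *: a i = 0 -> \sum_i l i = 0 -> forall i, l i = 0.

(* convex hull of the vertices a i with I i                                   *)
Definition face m (a : simplex R m n) (I : pred 'I_m) : set 'cV[R]_n :=
  [set x | exists l : 'I_m -> R, [/\ forall i, 0 <= l i, \sum_i l i = 1,
     forall i, ~~ I i -> l i = 0 & x = \sum_i l i *: a i]].
Definition hull m (a : simplex R m n) := face a predT.

(* (closure Om)° = Om: Om lies on one side of its boundary (no slits)        *)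
Definition polyhedral_domain (Om : set 'cV[R]_n) :=
  [/\ open Om, connected Om, Om !=set0 & bounded_set Om] /\
  (closure Om)° = Om /\
  exists2 F : seq (simplex R n n), (forall a, a \in F -> aff_indep a) &
    bdry Om = \bigcup_(a in [set a | a \in F]) hull a.

Definition diam (A : set 'cV[R]_n) : R := fine (ediam A).

Definition triangulation (Om : set 'cV[R]_n) (T : seq (simplex R n.+1 n)) :=
  [/\ forall a, a \in T -> aff_indep a,
      closure Om = \bigcup_(a in [set a | a \in T]) hull a &
      forall a b, a \in T -> b \in T ->
        hull a `&` hull b = face a (fun i => a i \in codom b)].

Definition facet (a : simplex R n.+1 n) (j : 'I_n.+1) := face a (predC1 j).

Definition fits_boundary (Om GD GN : set 'cV[R]_n) (T : seq (simplex R n.+1 n)) :=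
  forall a j, a \in T -> facet a j `<=` bdry Om ->
    facet a j `<=` closure GD \/ facet a j `<=` closure GN.

Definition mesh_size (T : seq (simplex R n.+1 n)) (h : R) :=
  (forall a, a \in T -> diam (hull a) <= h) /\
  (exists2 a, a \in T & diam (hull a) = h).

Definition regular_family (S : set R) (T : R -> seq (simplex R n.+1 n)) :=
  exists2 s : R, 0 < s & forall h a, S h -> a \in T h ->
    exists c rho, [/\ 0 < rho, [set x | enorm (x - c) <= rho] `<=` hull a
                    & diam (hull a) <= s * (2 * rho)].

(* polynomial functions of total degree at most k                             *)
Definition Pk (k : nat) : set ('cV[R]_n -> R) :=
  [set f | exists c : {ffun 'I_n -> 'I_k.+1} -> R, forall x : 'cV[R]_n,
     f x = \sum_(m : {ffun 'I_n -> 'I_k.+1} | (\sum_i m i <= k)%N)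
             c m * \prod_i x i ord0 ^+ m i].

End geometry.

Section discrete_spaces.
Context {R : realType} {n : nat}.
Variables (Om GD : set 'cV[R]_n) (T : seq (simplex R n.+1 n)) (k : nat).

Definition Ht : set (tfield R n) := [set q | L2tr Om q /\
  forall a, a \in T -> forall i j, exists2 f, Pk k f &
    {ae leb, forall x : 'cV[R]_n, hull a x -> q x i j = f x}].

Definition Hsigma : set (dfield R n) := [set p | Hdiv0 Om p /\
  forall a, a \in T -> forall i, exists (f : 'I_n -> 'cV[R]_n -> R) (g : 'cV[R]_n -> R),
    [/\ forall j, Pk k (f j), Pk k g &
      {ae leb, forall x : 'cV[R]_n, hull a x ->
         forall j, p.1 x i j = f j x + g x * x j ord0}]].

Definition Hphi : set (h1field R n) := [set p | [/\ H1 Om p,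
  {within closure Om, continuous p.1} &
  forall a, a \in T -> forall i, exists2 f, Pk k.+1 f &
    forall x, hull a x -> p.1 x i ord0 = f x]].

Definition Hu : set (h1field R n) :=
  [set p | Hphi p /\ forall x, bdry Om x -> p.1 x = 0].

Definition HphiD : set (h1field R n) :=
  [set p | Hphi p /\ trace Om GD p (cst 0)].

Definition HHh : set (state R n) :=
  [set xi | [/\ Ht xi.1.1, Hsigma xi.1.2 & Hu xi.2]].

Definition Wballh (r : R) (w phi : h1field R n) :=
  [/\ Hu w, Hphi phi & norm1 Om w + norm1 Om phi <= r].

Definition node (z : 'cV[R]_n) := exists2 a, a \in T &
  exists2 b : 'I_n.+1 -> nat, (\sum_i b i = k.+1)%N &
    z = \sum_i ((b i)%:R / k.+1%:R) *: a i.

(* The Scott-Zhang nodal functional N at the node z: integration against the  *)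
(* representative psi in P_(k+1) of the evaluation at z, over the element     *)
(* having z in its interior or else over a facet containing z (a boundary one *)
(* if z is on the boundary).                                                  *)
Definition SZ_nodal (z : 'cV[R]_n) (N : h1field R n -> 'cV[R]_n) :=
  (exists a, [/\ a \in T, (hull a)° z & exists psi, [/\ Pk k.+1 psi,
     forall p, Pk k.+1 p -> \int[leb]_(x in (hull a)°) (psi x * p x) = p z &
     forall v, H1 Om v -> forall i,
       N v i ord0 = \int[leb]_(x in (hull a)°) (psi x * v.1 x i ord0)]])
  \/
  ((forall a, a \in T -> ~ (hull a)° z) /\
   exists a j, [/\ a \in T, facet a j z, bdry Om z -> facet a j `<=` bdry Om &
     exists psi, [/\ Pk k.+1 psi,
       forall p, Pk k.+1 p -> \int[surf]_(x in facet a j) (psi x * p x) = p z &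
       forall v, H1 Om v -> exists2 g, trace Om (facet a j) v g &
         forall i, N v i ord0 = \int[surf]_(x in facet a j) (psi x * g x i ord0)]]).

(* The last condition is the requirement on the choice of the facets: the     *)
(* values on GD depend on the trace on GD only.                               *)
Definition scott_zhang (I : h1field R n -> h1field R n) :=
  [/\ forall v, H1 Om v -> Hphi (I v),
      forall z, node z -> SZ_nodal z (fun v => (I v).1 z) &
      forall v w, H1 Om v -> H1 Om w ->
        same_trace Om GD v w -> same_trace Om GD (I v) (I w)].

End discrete_spaces.

Record model (R : realType) (n : nat) := Model {
  nu : R -> R -> R;
  gam : R;
  alp : 'cV[R]_n;
  grav : 'cV[R]_n;
  KK : tfield R n;
  kap1 : R; kap2 : R; kap3 : R }.

Section forms.
Context {R : realType} {n : nat}.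
Variables (Om : set 'cV[R]_n) (D : model R n).
Local Notation int := (intO Om).

Definition nuf (phi : h1field R n) (x : 'cV[R]_n) : R :=
  nu D (vcomp (phi.1 x) 0) (vcomp (phi.1 x) 1).

Definition Aform (phi : h1field R n) (xi eta : state R n) : R :=
  let: (t, (s, ds), (u, gu)) := xi in
  let: (q, (tau, dtau), (v, gv)) := eta in
  2 * int (fun x => nuf phi x * ddot (t x) (q x - kap3 D *: dev (tau x)))
  + int (fun x => ddot (t x) (dev (tau x) - kap1 D *: symm (gv x)))
  - int (fun x => ddot (dev (s x)) (q x - kap3 D *: dev (tau x)))
  + (1 - kap2 D * gam D) * int (fun x => dotv (u x) (dtau x))
  - int (fun x => dotv (v x) (ds x))
  + int (fun x => ddot (skew (gu x)) (tau x))
  - int (fun x => ddot (s x) (skew (gv x)))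
  + gam D * int (fun x => dotv (u x) (v x))
  + kap2 D * int (fun x => dotv (ds x) (dtau x))
  + kap1 D * int (fun x => ddot (symm (gu x)) (symm (gv x))).

Definition Bform (w : h1field R n) (xi eta : state R n) : R :=
  let: (_, (u, _)) := xi in
  let: (q, (tau, _), _) := eta in
  int (fun x => ddot (dev (tensor (u x) (w.1 x))) (kap3 D *: dev (tau x) - q x)).

Definition Fform (phi : h1field R n) (eta : state R n) : R :=
  let: (_, (_, dtau), (v, _)) := eta in
  int (fun x => dotv (alp D) (phi.1 x) * dotv (grav D) (v x - kap2 D *: dtau x)).

Definition Cform (chi psi : h1field R n) : R :=
  int (fun x => ddot (KK D x *m chi.2 x) (psi.2 x)).

Definition Gform (w phi psi : h1field R n) : R :=
  - int (fun x => dotv (phi.2 x *m w.1 x) (psi.1 x)).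

(* xi is the value at (w, phi) of the solution operator of the flow problem   *)
(* with frozen convection and temperature                                     *)
Definition linear_sol (w phi : h1field R n) (xi : state R n) :=
  HH Om xi /\
  forall eta, HH Om eta -> Aform phi xi eta + Bform w xi eta = Fform phi eta.

Definition continuous_sol (GD : set 'cV[R]_n) (phiD : vfield R n)
    (xi : state R n) (phi : h1field R n) :=
  [/\ HH Om xi, H1 Om phi, trace Om GD phi phiD,
      forall eta, HH Om eta -> Aform phi xi eta + Bform xi.2 xi eta = Fform phi eta &
      forall psi, H1D Om GD psi -> Cform phi psi = Gform xi.2 phi psi].

(* phiDh is an H^1 field whose trace on GD is the discrete Dirichlet datum    *)
Definition discrete_sol (GD : set 'cV[R]_n) (T : seq (simplex R n.+1 n)) (k : nat)
    (phiDh : h1field R n) (xi : state R n) (phi : h1field R n) :=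
  [/\ HHh Om T k xi, Hphi Om T k phi, same_trace Om GD phi phiDh,
      forall eta, HHh Om T k eta ->
        Aform phi xi eta + Bform xi.2 xi eta = Fform phi eta &
      forall psi, HphiD Om GD T k psi -> Cform phi psi = Gform xi.2 phi psi].

Definition elliptic (alphaO : R) := forall phi xi, H1 Om phi -> HH Om xi ->
  alphaO * normHH Om xi ^+ 2 <= Aform phi xi xi.

Definition regularity (e r C : R) := forall w phi xi,
  Wball Om r w phi -> linear_sol w phi xi ->
  [/\ Hs Om e xi.1.1, Hs Om e xi.1.2.1, H1s Om e xi.2 &
      norms Om e xi.1.1 + norms Om e xi.1.2.1 + norm1s Om e xi.2
        <= C * enorm (alp D) * enorm (grav D) * norm0v Om phi.1].

Definition r0 (alphaO : R) : R :=
  alphaO / (2 * c1 Om * Num.sqrt (2 + kap3 D ^+ 2)).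
Definition CA (alphaO : R) : R :=
  2 * Num.sqrt 2 * Num.sqrt (2 + kap2 D ^+ 2) / alphaO.

Definition data_ok (nu1 nu2 Lnu k0 : R) :=
  [/\ 0 < gam D, 0 < nu1,
      forall a b, nu1 <= nu D a b <= nu2,
      forall a b a' b', `|nu D a b - nu D a' b'|
        <= Lnu * Num.sqrt ((a - a') ^+ 2 + (b - b') ^+ 2) & 0 < k0] /\
  [/\ forall i j, measurable_fun (Om : set (caratheodory_type leb_om))
                    (fun x => KK D x i j),
      exists M : R, {ae leb, forall x : 'cV[R]_n, Om x -> forall i j, `|KK D x i j| <= M} &
      {ae leb, forall x : 'cV[R]_n, Om x -> is_diag_mx (KK D x) /\
         forall y, k0 * enorm y ^+ 2 <= dotv (KK D x *m y) y}].

Definition kappa_ok (nu1 nu2 : R) := exists d1 d2 d3 : R,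
  [/\ 0 < d1 < nu2^-1, 0 < d2 < 2 / gam D & 0 < d3 < 1] /\
  [/\ 0 < kap3 D < 2 * nu1 * d1 / nu2, 0 < kap2 D < 2 * d2 &
      0 < kap1 D < 2 * d3 * (2 * nu1 - kap3 D * nu2 / d1)].

End forms.

(* Main.v *)
(* Testing the two temperature equations with psi = phi_h - I_h phi, whose
   trace on GD vanishes because I_h phi and I_h E have the same trace there,
   coercivity of the diffusion form and the embedding of H^1 into L^4 give
     alphat |psi| <= |K| |eta| + c1 (|u_h| |phi - phi_h| + |phi| |u - u_h|),
   where eta = phi - I_h phi; as c1 r <= alphat / 2, the term in phi - phi_h is
   absorbed and |phi - phi_h| <= C |eta| + |u - u_h|. In the assumed estimate
   for xi - xi_h the coefficient of |u - u_h| is then at most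
   CST (|alp||g| + |t|_eps + |u|_1) <= C1 |alp||g| <= 1/2, the regularity
   assumption bounding |t|_eps + |u|_1 by Chat r |alp||g|.
   Restrictions of smooth functions to the domain and to the boundary are
   measurable because a method II outer measure is a metric one. *)
Require Import Defs.
From mathcomp Require Import all_boot all_order all_algebra.
From mathcomp Require Import all_classical all_reals all_analysis.
From mathcomp Require Import measurable_realfun ring lra.
Import Order.TTheory GRing.Theory Num.Theory.
Import numFieldNormedType.Exports.
Local Open Scope classical_set_scope.
Local Open Scope ring_scope.

(** * Metric outer measures *)

(** Norm inequalities come from a pointwise Young inequality with a free parameter [l]: being linear
    in the squares it passes through finite sums and integrals alike, and optimizing over [l]
    afterwards gives back Cauchy-Schwarz or Minkowski. The two absorptions fit together because of
    the exact constants. The triangle inequality |phi - phi_h| <= |eta| + |psi| and the smallness of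
    [r] leave precisely the coefficient 1 in front of |u - u_h|; inserting this into the estimate
    for xi - xi_h therefore just adds the coefficients of the two errors, and a larger factor would
    spoil the bound 1/2. Integrals are total functions, so each splitting of a form must be
    justified by integrability. For the weak gradients this asks that test functions be square
    integrable on the domain, hence that bounded sets have finite measure, which is read off the
    method II construction through covers by small cubes. Traces are handled through witnesses:
    [same_trace] gives some common trace, and uniqueness of traces is never invoked. *)

Lemma mx_norm_le_enorm {R : realType} {n : nat} (v : 'cV[R]_n) : `|v| <= enorm v.
Proof.
rewrite -[leLHS]ger0_norm// -sqrtr_sqr ler_sqrt; last first.
  by apply: sumr_ge0 => i _; rewrite -expr2 sqr_ge0.
rewrite [X in X ^+ 2]/Num.norm/= mx_normrE; apply: (@big_ind _ (fun m => m ^+ 2 <= dotv v v)).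
- by rewrite expr0n; apply: sumr_ge0 => i _; rewrite -expr2 sqr_ge0.
- by move=> x y xv yv; rewrite maxEle; case: ifP.
- move=> [i j] _ /=; rewrite (ord1 j) real_normK ?num_real// /dotv (bigD1 i)//= -expr2.
  by rewrite lerDl; apply: sumr_ge0 => k _; rewrite -expr2 sqr_ge0.
Qed.

Section method_II_open.
Context {R : realType} {n : nat}.
Variable zeta : set 'cV[R]_n -> \bar R.
Hypothesis zeta_ge0 : forall A, (0 <= zeta A)%E.
Local Open Scope ereal_scope.

Let gauge_ge0 d A : 0 <= gauge_le zeta d A.
Proof. by rewrite /gauge_le; case: asboolP => // _; case: ifP. Qed.

Let gauge0 d : gauge_le zeta d set0 = 0.
Proof. by rewrite /gauge_le; case: asboolP. Qed.

(** A set meeting both [A] and [B] has diameter larger than [d], hence infinite gauge. A cover of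
    finite cost thus splits into the sets meeting [A] and those meeting [B], with no set used
    twice. *)
Lemma mu_ext_gauge_separated d (A B : set (allsets 'cV[R]_n)) :
  (forall x y, A x -> B y -> (d < enorm (x - y :> 'cV[R]_n))%R) ->
  mu_ext (gauge_le zeta d) A + mu_ext (gauge_le zeta d) B <=
  mu_ext (gauge_le zeta d) (A `|` B).
Proof.
move=> sep; apply: le_ereal_inf_tmp => _ [F [mF ABF] <-].
pose meet (C : set (allsets 'cV[R]_n)) k := if `[< F k `&` C !=set0 >] then F k else set0.
have cov C : C `<=` A `|` B -> measurable_cover C (meet C).
  move=> CAB; split=> [k|x Cx]; first by rewrite /meet; case: ifP.
  have [k _ Fkx] := ABF _ (CAB _ Cx); exists k => //.
  by rewrite /meet; case: asboolP => // -[]; exists x.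
apply: (@le_trans _ _ (\sum_(k <oo) gauge_le zeta d (meet A k) +
    \sum_(k <oo) gauge_le zeta d (meet B k))).
  apply: leeD; apply: ereal_inf_lbound.
    by exists (meet A) => //; apply: cov; exact: subsetUl.
  by exists (meet B) => //; apply: cov; exact: subsetUr.
rewrite -nneseriesD// lee_nneseries// => [k _ _|k _]; first exact: adde_ge0.
rewrite /meet; case: asboolP => [[x [Fx Ax]]|_]; last first.
  by rewrite gauge0 add0e; case: asboolP => // _; rewrite gauge0.
case: asboolP => [[y [Fy By]]|_]; last by rewrite gauge0 adde0.
suff -> : gauge_le zeta d (F k) = +oo by rewrite leey.
rewrite /gauge_le; case: asboolP => [F0|_]; first by rewrite F0 in Fx.
rewrite ifF//; apply/negbTE; rewrite -ltNge.
apply: (@lt_le_trans _ _ (enorm (x - y :> 'cV[R]_n))%:E).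
  by rewrite lte_fin sep.
by apply: ereal_sup_ubound; right; exists x => //; exists y.
Qed.

Lemma mu_ext_gauge_anti d d' (A : set (allsets 'cV[R]_n)) : (d <= d')%R ->
  mu_ext (gauge_le zeta d') A <= mu_ext (gauge_le zeta d) A.
Proof.
move=> dd'; apply: le_ereal_inf_tmp => _ [F [mF AF] <-].
apply: (@le_trans _ _ (\sum_(k <oo) gauge_le zeta d' (F k))).
  by apply: ereal_inf_lbound; exists F.
apply: lee_nneseries => // k _; rewrite /gauge_le; case: asboolP => // _.
have [Fd|_] := boolP (ediam (F k) <= d%:E); last by rewrite leey.
by rewrite (le_trans Fd) ?lee_fin.
Qed.

Lemma methodII_separated (c : R) (A B : set 'cV[R]_n) : (0 < c)%R ->
  (forall x y, A x -> B y -> (c <= `|x - y|)%R) ->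
  methodII zeta A + methodII zeta B <= methodII zeta (A `|` B).
Proof.
move=> c0 sep.
(* Two independent scales, since the two suprema on the left are independent; both are refined to a
   common scale below the separation, [c / 2] giving the strict inequality. *)
have le_min (d d' : R) : (0 < d)%R -> (0 < d')%R ->
    mu_ext (gauge_le zeta d) A + mu_ext (gauge_le zeta d') B <= methodII zeta (A `|` B).
  move=> d0 d'0; pose m := (Num.min (Num.min d d') (c / 2))%R.
  have m0 : (0 < m)%R by rewrite !lt_min d0 d'0 divr_gt0.
  apply: (@le_trans _ _ (mu_ext (gauge_le zeta m) (A `|` B))); last first.
    by apply: ereal_sup_ubound; exists m.
  apply: (@le_trans _ _ (mu_ext (gauge_le zeta m) A + mu_ext (gauge_le zeta m) B)).
    by apply: leeD; apply: mu_ext_gauge_anti; rewrite !ge_min lexx ?orbT.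
  apply: mu_ext_gauge_separated => x y Ax By.
  (* The separation is measured in the sup norm, the diameters in the gauge in the Euclidean
     norm. *)
  rewrite (lt_le_trans _ (mx_norm_le_enorm _))//.
  rewrite (lt_le_trans _ (sep _ _ Ax By))// (@le_lt_trans _ _ (c / 2)%R)//.
    by rewrite ge_min lexx orbT.
  by rewrite ltr_pdivrMr// ltr_pMr// ltr1n.
have [->|BNy] := eqVneq (methodII zeta (A `|` B)) +oo; first by rewrite leey.
have Bfin : methodII zeta (A `|` B) \is a fin_num.
  by rewrite ge0_fin_numE ?methodII_ge0// ltey.
have fin1 (d : R) : (0 < d)%R -> mu_ext (gauge_le zeta d) B \is a fin_num.
  move=> d0; rewrite ge0_fin_numE ?mu_ext_ge0//.
  apply: le_lt_trans (le_lt_trans (le_min d d d0 d0) _); last by rewrite ltey.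
  by rewrite leeDr// mu_ext_ge0.
have finA : methodII zeta A \is a fin_num.
  rewrite ge0_fin_numE ?methodII_ge0//.
  apply: (@le_lt_trans _ _ (methodII zeta (A `|` B))); last by rewrite ltey.
  by apply: le_methodII => //; exact: subsetUl.
(* Each supremum is bounded in turn with the other term moved to the right, which its finiteness
   permits. *)
rewrite addeC -leeBrDr//; apply: ge_ereal_sup => _ [d' d'0 <-].
rewrite leeBrDr// addeC -leeBrDr ?fin1//; apply: ge_ereal_sup => _ [d d0 <-].
by rewrite leeBrDr ?fin1//; exact: le_min.
Qed.

End method_II_open.

(* Caratheodory's criterion: the layers of [U] at distance between
   [1/(k+2)] and [1/(k+1)] from its complement are separated two by two, so
   that the sum of their measures converges. *)
Lemma metric_outer_measure_open {R : realType} {V : normedModType R}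
    (mu : {outer_measure set V -> \bar R}) (U : set V) :
  (forall (c : R) (A B : set V), 0 < c ->
    (forall x y, A x -> B y -> c <= `|x - y|) ->
    (mu A + mu B <= mu (A `|` B))%E) ->
  open U -> mu.-caratheodory U.
Proof.
move=> sep oU; apply: le_caratheodory_measurable => X.
have [->|XNy] := eqVneq (mu X) +oo%E; first by rewrite leey.
pose Uk k := [set x : V | forall y, ~ U y -> k.+1%:R^-1 <= `|x - y| :> R].
have Uk_le k l : (k <= l)%N -> Uk k `<=` Uk l.
  move=> kl x Ukx y Uy; apply: le_trans (Ukx y Uy).
  by rewrite lef_pV2 ?posrE// ler_nat.
have UkU k : Uk k `<=` U.
  move=> x Ukx; apply: contrapT => /Ukx; rewrite subrr normr0 leNgt => /negP; apply.
  by rewrite invr_gt0.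
have UkE : U `<=` \bigcup_k Uk k.
  move=> x Ux; have /nbhs_ballP[e /= e0 xeU] := open_nbhs_nbhs (conj oU Ux).
  exists (Num.truncn e^-1) => //= y Uy.
  rewrite leNgt; apply/negP => xy; apply: Uy; apply: xeU; rewrite -ball_normE/=.
  apply: (lt_trans xy); rewrite invf_plt ?posrE//.
  by rewrite truncnS_gt.
have Uk_sep k x y : Uk k x -> ~ Uk k.+1 y -> (k.+1%:R^-1 - k.+2%:R^-1 <= `|x - y| :> R).
  move=> Ukx /existsNP[z /not_implyP[Uz /negP]]; rewrite -ltNge => yz.
  rewrite lerBlDr (le_trans (Ukx z Uz))//.
  by rewrite (le_trans (ler_distD y _ _))// lerD2l ltW.
have c_gt0 k : 0 < k.+1%:R^-1 - k.+2%:R^-1 :> R.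
  by rewrite subr_gt0 ltf_pV2 ?posrE// ltr_nat.
pose D k := X `&` (Uk k.+1 `\` Uk k).
have sumD k : (\sum_(0 <= j < k.+1) mu (D j) <= mu (X `&` Uk k) + mu (X `&` Uk k.+1))%E.
  elim: k => [|k IHk].
    rewrite big_nat1 (le_trans _ (leeDr _ _))//.
    by apply: le_outer_measure => x [Xx []].
  rewrite big_nat_recr//= (le_trans (leeD2r _ IHk))// addeAC addeC leeD2l//.
  apply: le_trans (sep _ _ _ (c_gt0 k) _) _.
    by move=> x y [_ Ukx] [_ [_ /(Uk_sep _ _ _ Ukx)]].
  apply: le_outer_measure => x [[Xx Ukx]|[Xx [? _]]]; split => //.
  by apply: Uk_le Ukx; rewrite leqW.
have sumD_fin : (\sum_(0 <= j <oo) mu (D j) < +oo)%E.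
  apply: (@le_lt_trans _ _ (mu X + mu X)%E); last first.
    by rewrite lte_add_pinfty// ltey.
  apply: lime_le; first exact: is_cvg_nneseries.
  apply: nearW => k; apply: (@le_trans _ _ (\sum_(0 <= j < k.+1) mu (D j))%E).
    by rewrite big_nat_recr//= leeDl.
  by apply: le_trans (sumD k) _; apply: leeD; apply: le_outer_measure; exact: subIsetl.
have tail := nneseries_tail_cvg sumD_fin (fun k _ => outer_measure_ge0 mu (D k)).
(* [X] meets [U] in [Uk k] and the layers beyond [k], and [Uk k] is at distance at least
   [k.+1%:R^-1] from the complement of [U]; the error is the tail of a convergent series. *)
have bound k : (mu (X `&` U) + mu (X `&` ~` U) <= mu X + \sum_(k <= j <oo) mu (D j))%E.
  apply: (@le_trans _ _ (mu (X `&` Uk k) + \sum_(k <= j <oo) mu (D j)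
      + mu (X `&` ~` U))%E).
    rewrite leeD2r//.
    apply: le_trans (leeD2l _ (outer_measure_sigma_subadditive_tail mu k D)).
    apply: le_trans (outer_measureU2 _ _ _).
    apply: le_outer_measure => x [Xx /UkE Ux].
    have [l _ Ulx] := Ux.
    have [Ukx|Ukx] := pselect (Uk k x); [by left|right].
    have [j [kj [Ujx NUjx]]] : exists j, (k <= j)%N /\ Uk j.+1 x /\ ~ Uk j x.
      elim: l Ulx {Ux} => [U0x|l IHl Ulx].
        by exfalso; apply: Ukx; exact: Uk_le U0x.
      have [|] := pselect (Uk l x); first exact: IHl.
      move=> NUl; exists l; split => //; rewrite leqNgt; apply/negP => lk.
      by apply: Ukx; exact: Uk_le Ulx.
    by exists j => //=; rewrite /mkset ltnNge kj.
  rewrite addeAC leeD2r//; apply: le_trans (sep _ _ _ _ _) _; last first.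
  - apply: le_outer_measure => x [[Xx _]|[Xx _]]//.
  - by move=> x y [_ Ukx] [_ Uy]; exact: Ukx Uy.
  - by rewrite invr_gt0.
have lim : (mu X + \sum_(k <= j <oo) mu (D j))%E @[k --> \oo] --> (mu X + 0)%E.
  apply: cvgeD => //; last exact: cvg_cst.
  by rewrite fin_num_adde_defl.
rewrite adde0 in lim; rewrite -(cvg_lim _ lim)//.
apply: lime_ge; first by apply/cvg_ex; exists (mu X).
by apply: nearW.
Qed.

Lemma continuous_caratheodory_measurable {R : realType} {T : normedModType R}
    (mu : {outer_measure set T -> \bar R}) (D : set (caratheodory_type mu)) (f : T -> R) :
  (forall U : set T, open U -> mu.-caratheodory U) -> measurable D -> continuous f ->
  measurable_fun D (f : caratheodory_type mu -> R).
Proof.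
move=> muo mD cf; apply: (measurability _ (RGenOInfty.measurableE R)).
move=> _ [_ [a ->] <-].
change (mu.-caratheodory (D `&` f @^-1` `]a, +oo[)).
apply: caratheodory_measurable_setI => //.
by apply: muo; apply: open_comp; [move=> x _; exact: cf|exact: interval_open].
Qed.

(** * Lebesgue and surface outer measures *)

Section lebesgue_surface_measures.
Context {R : realType} {n : nat}.
Implicit Types U : set 'cV[R]_n.

Lemma boxvol_ge0 (A : set 'cV[R]_n) : (0 <= boxvol A)%E.
Proof.
rewrite /boxvol; elim/big_ind : _ => // [x y|i _]; first exact: mule_ge0.
by apply: ereal_sup_ubound; left.
Qed.

Lemma open_leb_measurable U : open U -> (@leb_om R n).-caratheodory U.
Proof.
apply: metric_outer_measure_open => c A B; apply: methodII_separated; exact: boxvol_ge0.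
Qed.

Lemma open_surf_measurable U : open U -> (@surf_om R n).-caratheodory U.
Proof.
apply: metric_outer_measure_open => c A B; apply: methodII_separated => C.
by apply: expe_ge0; apply: ereal_sup_ubound; left.
Qed.

Lemma ediam_le (A : set 'cV[R]_n) (d : R) : 0 <= d ->
  (forall x y, A x -> A y -> enorm (x - y) <= d) -> (ediam A <= d%:E)%E.
Proof.
move=> d0 Ad; apply: ge_ereal_sup => _ [->|[x Ax [y Ay <-]]]; rewrite lee_fin//.
exact: Ad.
Qed.

Lemma enorm_le_coord (x : 'cV[R]_n) (s : R) : 0 <= s ->
  (forall i, `|x i ord0| <= s) -> enorm x <= Num.sqrt n%:R * s.
Proof.
move=> s0 xs; rewrite -(ger0_norm s0) -sqrtr_sqr -sqrtrM ?ler0n// ler_sqrt; last first.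
  by rewrite mulr_ge0 ?sqr_ge0.
have -> : n%:R * s ^+ 2 = \sum_(i < n) s ^+ 2 by rewrite sumr_const card_ord mulr_natl.
apply: ler_sum => i _.
rewrite -expr2 -real_normK ?num_real//.
by rewrite ler_pXn2r ?nnegrE.
Qed.

(* [-M, 3M]^n is the union of N^n cubes of side 4M/N, whose total volume does
   not depend on N. *)
Lemma leb_bounded (A : set 'cV[R]_n) : bounded_set A -> (leb_om A < +oo)%E.
Proof.
move=> [M0 [_ AM0]]; pose M : R := Num.max 1 (M0 + 1).
have M_gt0 : 0 < M by rewrite lt_max ltr01.
have AM x i : A x -> `|x i ord0| <= M.
  move=> Ax; have xM : `|x| <= M by apply: AM0 => //; rewrite lt_max ltrDl ltr01 orbT.
  apply: le_trans xM; rewrite [leRHS]/Num.norm/= mx_normrE.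
  by apply: le_trans (le_bigmax _ _ (i, ord0)).
apply: (@le_lt_trans _ _ ((4 * M) ^+ n)%:E); last exact: ltry.
apply: ge_ereal_sup => _ [d d0 <-].
pose N := (Num.truncn (Num.sqrt n%:R * (4 * M) / d)).+1.
(* [N] makes the diagonal of a cube of side [s] at most [d]. The total side is [4 * M] rather than
   [2 * M], so that [x i ord0 + M <= 2 * M] always falls in a cube of index strictly below [N]. *)
pose s : R := 4 * M / N%:R.
have s0 : 0 < s by rewrite divr_gt0// mulr_gt0.
have sd : Num.sqrt n%:R * s <= d.
  rewrite mulrA ler_pdivrMr// [leRHS]mulrC -ler_pdivrMr// ltW//.
  exact: truncnS_gt.
pose cube (m : {ffun 'I_n -> 'I_N}) : set 'cV[R]_n :=
  [set x | forall i, s * (m i)%:R <= x i ord0 + M <= s * (m i).+1%:R].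
pose K := #|{: {ffun 'I_n -> 'I_N}}|.
(* The cubes are numbered below [K]; the sequence goes on with empty sets, whose gauge is 0. *)
pose F k := if insub k is Some i then cube (@enum_val _ {: {ffun 'I_n -> 'I_N}} i) else set0.
have cubeP m x y i : cube m x -> cube m y -> `|x i ord0 - y i ord0| <= s.
  move=> /(_ i)/andP[x1 x2] /(_ i)/andP[y1 y2].
  rewrite -natr1 mulrDr mulr1 in x2 y2.
  by rewrite ler_norml; apply/andP; split; lra.
have FE k : (gauge_le boxvol d (F k) <= if (k < K)%N then (s ^+ n)%:E else 0)%E.
  rewrite /F; case: insubP => [i ki _|/negbTE ->]; last first.
    by rewrite /gauge_le; case: asboolP.
  rewrite ki /gauge_le; case: asboolP => _; first by rewrite lee_fin exprn_ge0// ltW.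
  set m := enum_val i; rewrite ifT; last first.
    apply: ediam_le => [|x y mx my]; first exact: ltW.
    apply: le_trans sd; apply: enorm_le_coord => [|j]; first exact: ltW.
    by rewrite !mxE; exact: cubeP mx my.
  have -> : (s ^+ n)%:E = \big[mule/1%E]_(j < n) s%:E.
    by rewrite big_const card_ord; elim: (n) => //= p <-; rewrite exprS EFinM.
  rewrite /boxvol; apply: (@proj2 (0 <= \big[mule/1%E]_(j < n) width (cube m) j)%E).
  apply: (big_ind2 (fun x y : \bar R => (0 <= x /\ x <= y)%E)) => [||].
  - by split; rewrite ?lee01.
  - move=> a b c e [a0 ab] [c0 ce]; split; first exact: mule_ge0.
    exact: lee_pmul.
  - move=> j _; split; first by apply: ereal_sup_ubound; left.
    apply: ge_ereal_sup => _ [->|[x mx [y my <-]]]; rewrite lee_fin; first exact: ltW.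
    exact: cubeP mx my.
apply: (@le_trans _ _ (\sum_(k <oo) gauge_le boxvol d (F k))%E).
  apply: ereal_inf_lbound; exists F => //; split => // x Ax.
  have xM i : 0 <= x i ord0 + M <= 2 * M.
    by have := AM _ i Ax; rewrite ler_norml => /andP[? ?]; apply/andP; split; lra.
  have xt i : (Num.truncn ((x i ord0 + M) / s))%:R <= (x i ord0 + M) / s.
    by rewrite truncn_le divr_ge0 ?(ltW s0)//; case/andP: (xM i).
  have xb i : (Num.truncn ((x i ord0 + M) / s) < N)%N.
    rewrite -(ltr_nat R); apply: le_lt_trans (xt i) _.
    rewrite ltr_pdivrMr// /s mulrC divfK ?pnatr_eq0//.
    by have /andP[_] := xM i => x2; apply: le_lt_trans x2 _; lra.
  exists (enum_rank [ffun i => Ordinal (xb i)]) => //.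
  rewrite /F; case: insubP => [i _ ii|]; last by rewrite ltn_ord.
  have -> : i = enum_rank [ffun i => Ordinal (xb i)] by apply: val_inj.
  rewrite enum_rankK => j; rewrite ffunE/= mulrC -ler_pdivlMr// xt/=.
  by rewrite mulrC -ler_pdivrMr// ltW// truncnS_gt.
apply: (@le_trans _ _ (\sum_(k <oo) if (k < K)%N then (s ^+ n)%:E else 0)%E).
  apply: lee_nneseries => [k _ _|k _]; last exact: FE.
  by rewrite /gauge_le; case: asboolP => // _; case: ifP => // _; exact: boxvol_ge0.
rewrite (nneseries_split 0 K) => [|k _]; last first.
  by case: ifP => // _; rewrite lee_fin exprn_ge0// ltW.
rewrite [X in (_ + X)%E]eseries0 => [|k Kk _]; last by rewrite ltnNge Kk.
rewrite adde0 add0n big_nat (eq_bigr (fun=> (s ^+ n)%:E)) => [|k /andP[_ ->]//].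
rewrite -big_nat sumEFin lee_fin big_const_nat iter_addr_0 subn0.
rewrite /K card_ffun !card_ord -[leLHS]mulr_natr natrX -exprMn /s divfK ?pnatr_eq0//.
Qed.

End lebesgue_surface_measures.

(** * Young and Cauchy-Schwarz inequalities *)

Lemma le_sqrtM_of_young {R : realType} (a b c : R) : 0 <= a -> 0 <= b ->
  (forall l, 0 < l -> 2 * c <= l * a + l^-1 * b) -> c <= Num.sqrt a * Num.sqrt b.
Proof.
move=> a0 b0 young; set s := Num.sqrt a; set t := Num.sqrt b.
have s0 : 0 <= s by rewrite sqrtr_ge0.
have t0 : 0 <= t by rewrite sqrtr_ge0.
have aE : a = s * s by rewrite -expr2 sqr_sqrtr.
have bE : b = t * t by rewrite -expr2 sqr_sqrtr.
rewrite leNgt; apply/negP => stc.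
(* The optimal parameter is [t / s], but [s] or [t] may vanish, so both are shifted by [e]. Young
   then gives [2 * c <= 2 * s * t + e * (s + t)], and this [e] makes the excess smaller than
   [c - s * t]. *)
pose e := (c - s * t) / (s + t + 1).
have st1 : 0 < s + t + 1 by rewrite ltr_wpDl// addr_ge0.
have e0 : 0 < e by rewrite divr_gt0// subr_gt0.
have se : 0 < s + e by rewrite ltr_wpDl.
have te : 0 < t + e by rewrite ltr_wpDl.
have le1 : (t + e) / (s + e) * a <= (t + e) * s.
  rewrite -mulrA ler_wpM2l ?(ltW te)// mulrC ler_pdivrMr// aE.
  by rewrite ler_wpM2l// lerDl ltW.
have le2 : ((t + e) / (s + e))^-1 * b <= (s + e) * t.
  rewrite invf_div -mulrA ler_wpM2l ?(ltW se)// mulrC ler_pdivrMr// bE.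
  by rewrite ler_wpM2l// lerDl ltW.
have := le_trans (young _ (divr_gt0 te se)) (lerD le1 le2).
have : e * (s + t + 1) = c - s * t by rewrite /e divfK// gt_eqF.
nra.
Qed.

(** The infimum over [l] of the right side is [(a + b) ^+ 2]: the triangle inequality is recovered
    from bounds on squares, which add up over the components of a product norm. *)
Lemma minkowski_of_young {R : realType} (x a b : R) : 0 <= a -> 0 <= b ->
  (forall l, 0 < l -> x <= (1 + l) * a ^+ 2 + (1 + l^-1) * b ^+ 2) ->
  Num.sqrt x <= a + b.
Proof.
move=> a0 b0 young; rewrite -[leRHS]ger0_norm ?addr_ge0// -sqrtr_sqr.
rewrite ler_sqrt ?sqr_ge0//.
have := @le_sqrtM_of_young _ (a ^+ 2) (b ^+ 2) ((x - a ^+ 2 - b ^+ 2) / 2).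
rewrite !sqrtr_sqr !ger0_norm ?sqr_ge0// => /(_ isT isT) ab.
suff : (x - a ^+ 2 - b ^+ 2) / 2 <= a * b by lra.
apply: ab => l l0; have := young l l0; lra.
Qed.

Lemma young_prod {R : realType} (l x y : R) : 0 < l ->
  2 * (x * y) <= l * x ^+ 2 + l^-1 * y ^+ 2.
Proof.
move=> l0; rewrite -subr_ge0.
have -> : l * x ^+ 2 + l^-1 * y ^+ 2 - 2 * (x * y) = l^-1 * (l * x - y) ^+ 2.
  by field; rewrite gt_eqF.
by rewrite mulr_ge0 ?sqr_ge0// invr_ge0 ltW.
Qed.

Lemma young_sub {R : realType} (l x y : R) : 0 < l ->
  (x - y) ^+ 2 <= (1 + l) * x ^+ 2 + (1 + l^-1) * y ^+ 2.
Proof. by move=> l0; have := young_prod l x (- y) l0; nra. Qed.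

Section finite_dimension.
Context {R : realType} {n : nat}.
Implicit Types (u v w : 'cV[R]_n) (A B : 'M[R]_n).

Definition frob A : R := Num.sqrt (ddot A A).

Lemma dotvv_ge0 v : 0 <= dotv v v.
Proof. by apply: sumr_ge0 => i _; rewrite -expr2 sqr_ge0. Qed.

Lemma ddotAA_ge0 A : 0 <= ddot A A.
Proof. by apply: sumr_ge0 => i _; apply: sumr_ge0 => j _; rewrite -expr2 sqr_ge0. Qed.

Lemma sqr_enorm v : enorm v ^+ 2 = dotv v v.
Proof. by rewrite sqr_sqrtr ?dotvv_ge0. Qed.

Lemma sqr_frob A : frob A ^+ 2 = ddot A A.
Proof. by rewrite sqr_sqrtr ?ddotAA_ge0. Qed.

Lemma ddot_le_frob A B : ddot A B <= frob A * frob B.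
Proof.
apply: le_sqrtM_of_young; rewrite ?ddotAA_ge0// => l l0.
rewrite /ddot !mulr_sumr -big_split; apply: ler_sum => i _.
rewrite !mulr_sumr -big_split; apply: ler_sum => j _ /=.
by rewrite -!expr2 young_prod.
Qed.

Lemma ddotNr A B : ddot A (- B) = - ddot A B.
Proof.
rewrite /ddot -sumrN; apply: eq_bigr => i _; rewrite -sumrN; apply: eq_bigr => j _.
by rewrite mxE mulrN.
Qed.

Lemma normr_ddot_le_frob A B : `|ddot A B| <= frob A * frob B.
Proof.
rewrite ler_norml ddot_le_frob lerNl -ddotNr andbT (le_trans (ddot_le_frob _ _))//.
rewrite /frob [X in _ * Num.sqrt X](_ : _ = ddot B B)// ddotNr.
rewrite -[RHS]opprK; congr (- _); rewrite -ddotNr /ddot.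
by apply: eq_bigr => i _; apply: eq_bigr => j _; rewrite mulrC.
Qed.

(** The left side is the contraction of [A] with [tensor v w], whose Frobenius norm is controlled by
    the product of the two Euclidean norms. *)
Lemma normr_dotv_mulmx A v w : `|dotv (A *m w) v| <= frob A * (enorm w * enorm v).
Proof.
have -> : dotv (A *m w) v = ddot A (tensor v w).
  apply: eq_bigr => i _; rewrite mxE mulr_suml; apply: eq_bigr => j _.
  by rewrite mxE big_ord1 !mxE -mulrA [w _ _ * _]mulrC.
apply: le_trans (normr_ddot_le_frob _ _) _; rewrite ler_wpM2l ?sqrtr_ge0//.
rewrite /frob /enorm -sqrtrM ?dotvv_ge0// ler_sqrt ?mulr_ge0 ?dotvv_ge0//.
rewrite mulrC /dotv mulr_suml; apply: ler_sum => i _; rewrite mulr_sumr.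
by apply: ler_sum => j _; rewrite !mxE big_ord1 !mxE mulrACA.
Qed.

Lemma dotv_young_sub l u v : 0 < l ->
  dotv (u - v) (u - v) <= (1 + l) * dotv u u + (1 + l^-1) * dotv v v.
Proof.
move=> l0; rewrite /dotv !mulr_sumr -big_split; apply: ler_sum => i _.
by rewrite !mxE -!expr2 young_sub.
Qed.

Lemma ddot_young_sub l A B : 0 < l ->
  ddot (A - B) (A - B) <= (1 + l) * ddot A A + (1 + l^-1) * ddot B B.
Proof.
move=> l0; rewrite /ddot !mulr_sumr -big_split; apply: ler_sum => i _.
rewrite !mulr_sumr -big_split; apply: ler_sum => j _.
by rewrite !mxE -!expr2 young_sub.
Qed.

(** The coercivity of [KK] is given on vectors; this carries it over to gradients, column by
    column. *)
Lemma ddot_mulmx_col A B : ddot (A *m B) B = \sum_j dotv (A *m col j B) (col j B).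
Proof.
rewrite /ddot exchange_big; apply: eq_bigr => j _; apply: eq_bigr => i _.
by rewrite !mxE; congr (_ * _); apply: eq_bigr => k _; rewrite mxE.
Qed.

Lemma ddot_col B : ddot B B = \sum_j enorm (col j B) ^+ 2.
Proof.
rewrite /ddot exchange_big; apply: eq_bigr => j _; rewrite sqr_enorm.
by apply: eq_bigr => i _; rewrite !mxE.
Qed.

(** A diagonal matrix only rescales the rows, so the bound on the entries serves without a factor
    depending on the dimension. *)
Lemma frob_diag_mulmx (M : R) A B : is_diag_mx A -> (forall i j, `|A i j| <= M) ->
  frob (A *m B) <= `|M| * frob B.
Proof.
move=> /is_diag_mxP Ad AM; rewrite -[`|M|]normr_id -sqrtr_sqr -sqrtrM ?sqr_ge0//.
rewrite ler_sqrt ?mulr_ge0 ?sqr_ge0 ?ddotAA_ge0//.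
rewrite /ddot mulr_sumr; apply: ler_sum => i _; rewrite mulr_sumr; apply: ler_sum => j _.
rewrite mxE (bigD1 i)//= big1 ?addr0 => [|k ki]; last first.
  by rewrite Ad ?mul0r// eq_sym.
rewrite -!expr2 exprMn ler_wpM2r ?sqr_ge0//.
rewrite -[leLHS]real_normK ?num_real// ler_pXn2r ?nnegrE//.
by rewrite (le_trans (AM _ _))// ler_norm.
Qed.

Lemma enormZ (c : R) (x : 'cV[R]_n) : enorm (c *: x) = `|c| * enorm x.
Proof.
rewrite /enorm -sqrtr_sqr -sqrtrM ?sqr_ge0//; congr Num.sqrt.
by rewrite /dotv mulr_sumr; apply: eq_bigr => i _; rewrite !mxE; ring.
Qed.

Lemma frobZ (c : R) (A : 'M[R]_n) : frob (c *: A) = `|c| * frob A.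
Proof.
rewrite /frob -sqrtr_sqr -sqrtrM ?sqr_ge0//; congr Num.sqrt.
rewrite /ddot mulr_sumr; apply: eq_bigr => i _; rewrite mulr_sumr.
by apply: eq_bigr => j _; rewrite !mxE; ring.
Qed.

Lemma dotvBl (u v w : 'cV[R]_n) : dotv (u - v) w = dotv u w - dotv v w.
Proof. by rewrite /dotv -sumrB; apply: eq_bigr => i _; rewrite !mxE mulrBl. Qed.

Lemma ddotBl (A B C : 'M[R]_n) : ddot (A - B) C = ddot A C - ddot B C.
Proof.
rewrite /ddot -sumrB; apply: eq_bigr => i _; rewrite -sumrB; apply: eq_bigr => j _.
by rewrite !mxE mulrBl.
Qed.

End finite_dimension.

(** * Square integrable functions *)

Section square_integrable.
Context d (T : measurableType d) (R : realType) (mu : {measure set T -> \bar R}).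
Variable D : set T.
Hypothesis mD : measurable D.
Implicit Types f g h : T -> R.

(** Over an arbitrary measure; on [leb] and a domain it unfolds to [L2]. *)
Definition L2on f :=
  measurable_fun D f /\ (\int[mu]_(x in D) (f x ^+ 2)%:E < +oo)%E.
Definition nrm2 f : R := Num.sqrt (fine (\int[mu]_(x in D) (f x ^+ 2)%:E)%E).

Lemma integral_sqr_ge0 f : (0 <= \int[mu]_(x in D) (f x ^+ 2)%:E)%E.
Proof. by apply: integral_ge0 => x _; rewrite lee_fin sqr_ge0. Qed.

Lemma measurable_sqr f : measurable_fun D f -> measurable_fun D (fun x => (f x ^+ 2)%:E).
Proof. by move=> mf; apply/measurable_EFinP; exact: measurable_funX. Qed.

Lemma integrable_le f g : measurable_fun D f -> (forall x, D x -> `|f x| <= g x) ->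
  mu.-integrable D (EFin \o g) -> mu.-integrable D (EFin \o f).
Proof.
move=> mf fg; apply: le_integrable => //; first exact/measurable_EFinP.
by move=> x Dx; rewrite lee_fin (le_trans (fg x Dx))// ler_norm.
Qed.

Lemma L2on_sqr_integrable f : L2on f -> mu.-integrable D (EFin \o (fun x => f x ^+ 2)).
Proof.
move=> [mf foo]; apply/integrableP; split; first exact: measurable_sqr.
by under eq_integral do rewrite /= ger0_norm ?sqr_ge0//.
Qed.

Lemma sqr_nrm2 f : nrm2 f ^+ 2 = \int[mu]_(x in D) (f x ^+ 2).
Proof. by rewrite sqr_sqrtr// fine_ge0// integral_sqr_ge0. Qed.

Lemma measurable_lin (a b : R) f g : measurable_fun D f -> measurable_fun D g ->
  measurable_fun D (fun x => a * f x + b * g x).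
Proof. by move=> mf mg; apply: measurable_funD; exact: measurable_funM. Qed.

Lemma integrable_lin (a b : R) f g :
  mu.-integrable D (EFin \o f) -> mu.-integrable D (EFin \o g) ->
  mu.-integrable D (EFin \o (fun x => a * f x + b * g x)).
Proof.
move=> fi gi; have := integrableD mD (integrableZl mD a fi) (integrableZl mD b gi).
by apply: eq_integrable.
Qed.

Lemma Rintegral_lin (a b : R) f g :
  mu.-integrable D (EFin \o f) -> mu.-integrable D (EFin \o g) ->
  \int[mu]_(x in D) (a * f x + b * g x) =
  a * \int[mu]_(x in D) f x + b * \int[mu]_(x in D) g x.
Proof.
move=> fi gi; have := RintegralD mD (integrableZl mD a fi) (integrableZl mD b gi).
by rewrite !RintegralZl.
Qed.

Lemma L2on_prod_integrable f g : L2on f -> L2on g ->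
  mu.-integrable D (EFin \o (fun x => f x * g x)).
Proof.
move=> Lf Lg; apply: integrable_le; last first.
- exact: integrable_lin 1 1 _ _ (L2on_sqr_integrable _ Lf) (L2on_sqr_integrable _ Lg).
- move=> x _ /=; rewrite !mul1r normrM.
  have := young_prod 1 `|f x| `|g x| ltr01; rewrite invr1 !mul1r !real_normK ?num_real//.
  have : 0 <= `|f x| * `|g x| by []; lra.
- by apply: measurable_funM; [case: Lf|case: Lg].
Qed.

Lemma cauchy_schwarz f g : L2on f -> L2on g ->
  \int[mu]_(x in D) (f x * g x) <= nrm2 f * nrm2 g.
Proof.
move=> Lf Lg; apply: le_sqrtM_of_young; rewrite ?fine_ge0 ?integral_sqr_ge0// => l l0.
rewrite -RintegralZl//; last exact: L2on_prod_integrable.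
rewrite -Rintegral_lin; try exact: L2on_sqr_integrable.
apply: le_Rintegral => //.
- by have := integrableZl mD 2 (L2on_prod_integrable _ _ Lf Lg); apply: eq_integrable.
- by apply: integrable_lin; exact: L2on_sqr_integrable.
- by move=> x _; exact: young_prod.
Qed.

(** Kept in the extended reals so that it applies before finiteness is known, both to prove square
    integrability and to compare the distances to approximating sequences of a trace. *)
Lemma integral_lin_le (a b : R) f g h : 0 <= a -> 0 <= b ->
  measurable_fun D f -> measurable_fun D g -> measurable_fun D h ->
  (forall x, D x -> 0 <= f x) -> (forall x, D x -> 0 <= g x) ->
  (forall x, D x -> 0 <= h x) -> (forall x, D x -> h x <= a * f x + b * g x) ->
  (\int[mu]_(x in D) (h x)%:E <=
   a%:E * \int[mu]_(x in D) (f x)%:E + b%:E * \int[mu]_(x in D) (g x)%:E)%E.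
Proof.
move=> a0 b0 /measurable_EFinP mf /measurable_EFinP mg mh f0 g0 h0 hfg.
have fE x : D x -> (0 <= (f x)%:E)%E by move=> Dx; rewrite lee_fin f0.
have gE x : D x -> (0 <= (g x)%:E)%E by move=> Dx; rewrite lee_fin g0.
have afE x : D x -> (0 <= a%:E * (f x)%:E)%E by move=> Dx; rewrite mule_ge0// fE.
have bgE x : D x -> (0 <= b%:E * (g x)%:E)%E by move=> Dx; rewrite mule_ge0// gE.
have maf : measurable_fun D (fun x => a%:E * (f x)%:E)%E by exact: measurable_funeM.
have mbg : measurable_fun D (fun x => b%:E * (g x)%:E)%E by exact: measurable_funeM.
rewrite -!ge0_integralZl// -ge0_integralD//; apply: ge0_le_integral => //.
- exact/measurable_EFinP.
- exact: emeasurable_funD.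
Qed.

Lemma L2on_lin (a b : R) f g : L2on f -> L2on g -> L2on (fun x => a * f x + b * g x).
Proof.
move=> [mf foo] [mg goo]; have mh : measurable_fun D (fun x => a * f x + b * g x).
  exact: measurable_lin.
split => //; apply: le_lt_trans.
  apply: (@integral_lin_le (2 * a ^+ 2) (2 * b ^+ 2) (fun x => f x ^+ 2) (fun x => g x ^+ 2)
      (fun x => (a * f x + b * g x) ^+ 2)).
  - by rewrite mulr_ge0 ?sqr_ge0.
  - by rewrite mulr_ge0 ?sqr_ge0.
  - exact: measurable_funX.
  - exact: measurable_funX.
  - exact: measurable_funX.
  - by move=> x _; rewrite sqr_ge0.
  - by move=> x _; rewrite sqr_ge0.
  - by move=> x _; rewrite sqr_ge0.
  - move=> x _; have := sqr_ge0 (a * f x - b * g x); lra.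
by rewrite lte_add_pinfty// lte_mul_pinfty ?integral_sqr_ge0// lee_fin mulr_ge0 ?sqr_ge0.
Qed.

Lemma L2on_sqrt_sum (I : finType) (F : I -> T -> R) :
  (forall i, L2on (F i)) -> L2on (fun x => Num.sqrt (\sum_i F i x ^+ 2)).
Proof.
move=> LF; have ms : measurable_fun D (fun x => \sum_i F i x ^+ 2).
  by apply: measurable_sum => i; apply: measurable_funX; case: (LF i).
split.
  apply: (@measurableT_comp _ _ _ _ _ _ (@Num.sqrt R)) ms.
  by apply: continuous_measurable_fun; exact: sqrt_continuous.
rewrite (eq_integral (fun x => \sum_i (F i x ^+ 2)%:E)%E); last first.
  by move=> x _; rewrite sqr_sqrtr ?sumEFin// sumr_ge0// => i _; exact: sqr_ge0.
rewrite ge0_integral_sum//; last 2 first.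
- by move=> i; apply: measurable_sqr; case: (LF i).
- by move=> i x _; rewrite lee_fin sqr_ge0.
by apply: lte_sum_pinfty => i _; case: (LF i).
Qed.

(** [f] agrees almost everywhere with its absolute value. The bounds on [KK] hold only almost
    everywhere, so integrals involving it are compared through the sign of a difference. *)
Lemma Rintegral_ae_ge0 f : measurable_fun D f ->
  {ae mu, forall x, D x -> 0 <= f x} -> 0 <= \int[mu]_(x in D) f x.
Proof.
move=> mf f0; rewrite /Rintegral (@ae_eq_integral _ _ _ _ _ (fun x => `|f x|%:E))//.
- by apply: fine_ge0; apply: integral_ge0 => x _; rewrite lee_fin.
- exact/measurable_EFinP.
- by apply/measurable_EFinP; exact: measurableT_comp.
- by apply: filterS f0 => x f0 Dx; rewrite ger0_norm// f0.
Qed.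

Lemma ae_le_integrable f g : measurable_fun D f -> (forall x, D x -> 0 <= g x) ->
  {ae mu, forall x, D x -> `|f x| <= g x} ->
  mu.-integrable D (EFin \o g) -> mu.-integrable D (EFin \o f).
Proof.
move=> mf g0 fg /integrableP[mg goo]; apply/integrableP; split; first exact/measurable_EFinP.
apply: le_lt_trans goo; apply: ae_ge0_le_integral => //.
- by apply: measurableT_comp => //; exact/measurable_EFinP.
- exact: measurableT_comp.
- apply: filterS fg => x fg Dx; rewrite /= lee_fin (le_trans (fg Dx))//.
  by rewrite ler_norm.
Qed.

Lemma ae_impl2 (P Q S : T -> Prop) : (forall x, P x -> Q x -> S x) ->
  {ae mu, forall x, P x} -> {ae mu, forall x, Q x} -> {ae mu, forall x, S x}.
Proof. by move=> PQS aP aQ; apply: filterS2 aP aQ. Qed.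

End square_integrable.

Arguments L2on {d T R} mu D f.
Arguments nrm2 {d T R} mu D f.
Arguments cauchy_schwarz {d T R} [mu D] mD [f g].
Arguments L2on_prod_integrable {d T R} [mu D] mD [f g].
Arguments L2on_lin {d T R} [mu D] mD a b [f g].
Arguments integrable_le {d T R} [mu D] mD [f] g.
Arguments integrable_lin {d T R} [mu D] mD a b [f g].
Arguments Rintegral_lin {d T R} [mu D] mD a b [f g].
Arguments ae_le_integrable {d T R} [mu D] mD [f] g.
Arguments Rintegral_ae_ge0 {d T R} [mu D] mD [f].
Arguments ae_impl2 {d T R} mu [P Q S].
Arguments measurable_lin {d T R} [D] a b [f g].

(** * Vector and tensor fields *)

Section fields.
Context d (T : measurableType d) (R : realType) (mu : {measure set T -> \bar R}) (n : nat).
Variable D : set T.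
Hypothesis mD : measurable D.
Implicit Types (u v : T -> 'cV[R]_n) (A B : T -> 'M[R]_n).

Definition measv v := forall i, measurable_fun D (fun x => v x i ord0).
Definition meast A := forall i j, measurable_fun D (fun x => A x i j).

Lemma measurable_dotv u v : measv u -> measv v ->
  measurable_fun D (fun x => dotv (u x) (v x)).
Proof. by move=> mu_ mv; apply: measurable_sum => i; exact: measurable_funM. Qed.

Lemma measurable_ddot A B : meast A -> meast B ->
  measurable_fun D (fun x => ddot (A x) (B x)).
Proof.
by move=> mA mB; apply: measurable_sum => i; apply: measurable_sum => j; exact: measurable_funM.
Qed.

Lemma measv_sub u v : measv u -> measv v -> measv (u \- v).
Proof.
move=> mu_ mv i; rewrite (_ : (fun _ => _) = (fun x => u x i ord0 - v x i ord0)).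
  exact: measurable_funB.
by apply/funext => x; rewrite !mxE.
Qed.

Lemma meast_sub A B : meast A -> meast B -> meast (A \- B).
Proof.
move=> mA mB i j; rewrite (_ : (fun _ => _) = (fun x => A x i j - B x i j)).
  exact: measurable_funB.
by apply/funext => x; rewrite !mxE.
Qed.

Lemma measv_mulmx A v : meast A -> measv v -> measv (fun x => A x *m v x).
Proof.
move=> mA mv i; rewrite (_ : (fun _ => _) = (fun x => \sum_j A x i j * v x j ord0)).
  by apply: measurable_sum => j; exact: measurable_funM.
by apply/funext => x; rewrite mxE.
Qed.

Lemma meast_mulmx A B : meast A -> meast B -> meast (fun x => A x *m B x).
Proof.
move=> mA mB i k; rewrite (_ : (fun _ => _) = (fun x => \sum_j A x i j * B x j k)).
  by apply: measurable_sum => j; exact: measurable_funM.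
by apply/funext => x; rewrite mxE.
Qed.

Lemma integral_dotv_sub l u v : 0 < l -> measv u -> measv v ->
  (\int[mu]_(x in D) (dotv (u x - v x) (u x - v x))%:E <=
   (1 + l)%:E * \int[mu]_(x in D) (dotv (u x) (u x))%:E +
   (1 + l^-1)%:E * \int[mu]_(x in D) (dotv (v x) (v x))%:E)%E.
Proof.
move=> l0 mu_ mv; apply: integral_lin_le => //.
- by rewrite addr_ge0// ltW.
- by rewrite addr_ge0// invr_ge0 ltW.
- exact: measurable_dotv.
- exact: measurable_dotv.
- by apply: (@measurable_dotv (u \- v) (u \- v)); exact: measv_sub.
- by move=> x _; exact: dotvv_ge0.
- by move=> x _; exact: dotvv_ge0.
- by move=> x _; exact: dotvv_ge0.
- by move=> x _; exact: dotv_young_sub.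
Qed.

Lemma integral_ddot_sub l A B : 0 < l -> meast A -> meast B ->
  (\int[mu]_(x in D) (ddot (A x - B x) (A x - B x))%:E <=
   (1 + l)%:E * \int[mu]_(x in D) (ddot (A x) (A x))%:E +
   (1 + l^-1)%:E * \int[mu]_(x in D) (ddot (B x) (B x))%:E)%E.
Proof.
move=> l0 mA mB; apply: integral_lin_le => //.
- by rewrite addr_ge0// ltW.
- by rewrite addr_ge0// invr_ge0 ltW.
- exact: measurable_ddot.
- exact: measurable_ddot.
- by apply: (@measurable_ddot (A \- B) (A \- B)); exact: meast_sub.
- by move=> x _; exact: ddotAA_ge0.
- by move=> x _; exact: ddotAA_ge0.
- by move=> x _; exact: ddotAA_ge0.
- by move=> x _; exact: ddot_young_sub.
Qed.

Lemma L2on_enorm v : (forall i, L2on mu D (fun x => v x i ord0)) ->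
  L2on mu D (fun x => enorm (v x)).
Proof.
move=> Lv; rewrite (_ : (fun _ => _) = (fun x => Num.sqrt (\sum_i v x i ord0 ^+ 2))).
  exact: L2on_sqrt_sum.
by apply/funext => x; congr Num.sqrt; apply: eq_bigr => i _; rewrite expr2.
Qed.

Lemma L2on_frob A : (forall i j, L2on mu D (fun x => A x i j)) ->
  L2on mu D (fun x => frob (A x)).
Proof.
move=> LA; rewrite (_ : (fun _ => _) =
    (fun x => Num.sqrt (\sum_(p : 'I_n * 'I_n) A x p.1 p.2 ^+ 2))).
  by apply: L2on_sqrt_sum => //; case.
apply/funext => x; congr Num.sqrt; rewrite /ddot pair_big.
by apply: eq_bigr => -[i j] _; rewrite expr2.
Qed.

End fields.

Arguments measv {d T R n} D v.
Arguments meast {d T R n} D A.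
Arguments measurable_dotv {d T R n} [D u v].
Arguments measurable_ddot {d T R n} [D A B].
Arguments measv_sub {d T R n} [D u v].
Arguments meast_sub {d T R n} [D A B].
Arguments measv_mulmx {d T R n} [D A v].
Arguments meast_mulmx {d T R n} [D A B].
Arguments integral_dotv_sub {d T R} mu {n D} mD l [u v].
Arguments integral_ddot_sub {d T R} mu {n D} mD l [A B].
Arguments L2on_enorm {d T R mu n D} mD [v].
Arguments L2on_frob {d T R mu n D} mD [A].

Lemma L2_lin {R : realType} {n : nat} (Om : set 'cV[R]_n) (a b : R) (f g : 'cV[R]_n -> R) :
  open Om -> L2 Om f -> L2 Om g -> L2 Om (fun x => a * f x + b * g x).
Proof. by move=> oO; apply: L2on_lin; exact: open_leb_measurable. Qed.

(** * Continuous functions on bounded domains *)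

Lemma normr_entry_le {R : realType} {m n : nat} (A : 'M[R]_(m, n)) i j : `|A i j| <= `|A|.
Proof.
by rewrite [leRHS]/Num.norm/= mx_normrE; apply: le_trans (le_bigmax _ _ (i, j)).
Qed.

Lemma normr_trmx_le {R : realType} {m n : nat} (A : 'M[R]_(m, n)) : `|A^T| <= `|A|.
Proof.
rewrite [leLHS]/Num.norm/= mx_normrE; apply: bigmax_le => // -[i j] _ /=.
by rewrite mxE normr_entry_le.
Qed.

(** Compactness of closed balls is taken from row vectors and carried over by transposition, an
    isometry for the sup norm. *)
Lemma continuous_bounded_cV {R : realType} {n : nat} (f : 'cV[R]_n -> R) (M : R) :
  continuous f -> exists K : R, forall x, `|x| <= M -> `|f x| <= K.
Proof.
move=> cf.
have ntr (x : 'rV[R]_n) : `|x^T| = `|x|.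
  by apply/eqP; rewrite eq_le normr_trmx_le -{1}(trmxK x) normr_trmx_le.
have ctr : continuous (fun x : 'rV[R]_n => x^T : 'cV[R]_n).
  move=> x; apply/(@cvgrPdist_lt _ 'cV[R]_n _ (nbhs x)) => e e0.
  apply/nbhs_ballP; exists e => // y.
  by rewrite -ball_normE /= -linearB ntr.
have cB : compact [set x : 'rV[R]_n | `|x| <= M].
  apply: bounded_closed_compact.
    by exists M; split; [exact: num_real|move=> N MN x /= /le_trans; apply; exact: ltW].
  apply: (@closed_comp _ _ (fun x : 'rV[R]_n => `|x|) [set y | y <= M]).
    by move=> x _; exact: norm_continuous.
  exact: closed_le.
have /compact_bounded[K [_ KP]] : compact ((fun x : 'rV[R]_n => f x^T) @` [set x | `|x| <= M]).
  apply: continuous_compact => //; apply: continuous_subspaceT => x.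
  by apply: continuous_comp; [exact: ctr|exact: cf].
exists (K + 1) => x xM; apply: KP; first by rewrite ltrDl.
by exists x^T; rewrite /= ?trmxK// -ntr trmxK.
Qed.

Section sobolev_domain.
Context {R : realType} {n : nat}.
Variable Om : set 'cV[R]_n.
Hypotheses (oO : open Om) (bO : bounded_set Om).
Local Notation T := (caratheodory_type (@leb_om R n)).

Lemma measurable_Om : measurable (Om : set T).
Proof. exact: open_leb_measurable. Qed.
Local Notation mO := measurable_Om.

Lemma continuous_measurable (f : 'cV[R]_n -> R) : continuous f ->
  measurable_fun (Om : set T) f.
Proof.
by apply: continuous_caratheodory_measurable; [exact: open_leb_measurable|exact: mO].
Qed.

Lemma continuous_L2 (f : 'cV[R]_n -> R) : continuous f -> L2 Om f.
Proof.
move=> cf; split; first exact: continuous_measurable.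
have [M [_ /(_ (M + 1))]] := bO; rewrite ltrDl ltr01 => /(_ isT) OM.
have [K fK] := continuous_bounded_cV f (M + 1) cf.
apply: (@le_lt_trans _ _ (\int[leb]_(x in (Om : set T)) (K ^+ 2)%:E)%E); last first.
  rewrite integral_cst//; last exact: mO.
  by apply: lte_mul_pinfty; [rewrite lee_fin sqr_ge0| |exact: leb_bounded].
apply: ge0_le_integral; first exact: mO.
- by move=> x _; rewrite lee_fin sqr_ge0.
- by apply: measurable_sqr; exact: continuous_measurable.
- exact: measurable_cst.
move=> x Ox; rewrite lee_fin -(real_normK (num_real (f x))) ler_pXn2r ?nnegrE//.
  exact/fK/OM.
by apply: le_trans (fK x _); [|exact: OM].
Qed.

End sobolev_domain.

(** * Sobolev spaces *)

Section sobolev_fields.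
Context {R : realType} {n : nat}.
Variable Om : set 'cV[R]_n.
Hypotheses (oO : open Om) (bO : bounded_set Om).
Local Notation T := (caratheodory_type (@leb_om R n)).
Local Notation mO := (measurable_Om Om oO).

Lemma smooth_continuous (f : 'cV[R]_n -> R) : smooth f -> continuous f.
Proof. by move=> /(_ [::])[]. Qed.

Lemma smooth_partial_continuous (f : 'cV[R]_n -> R) j : smooth f -> continuous (partial j f).
Proof. by move=> /(_ [:: j])[]. Qed.

Lemma intO_lin (a b : R) (f g : 'cV[R]_n -> R) :
  leb.-integrable (Om : set T) (EFin \o f) -> leb.-integrable (Om : set T) (EFin \o g) ->
  intO Om (fun x => a * f x + b * g x) = a * intO Om f + b * intO Om g.
Proof. exact: (Rintegral_lin mO). Qed.

Definition h1_lin (a b : R) (p q : h1field R n) : h1field R n :=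
  (fun x => a *: p.1 x + b *: q.1 x, fun x => a *: p.2 x + b *: q.2 x).

Lemma h1_subE (p q : h1field R n) : p - q = h1_lin 1 (-1) p q.
Proof.
rewrite /h1_lin; case: p q => [p P] [q Q] /=.
by congr pair; apply/funext => x; rewrite scale1r scaleN1r.
Qed.

Lemma H1_lin a b p q : H1 Om p -> H1 Om q -> H1 Om (h1_lin a b p q).
Proof.
move=> [Lp1 Lp2 wp] [Lq1 Lq2 wq]; split => [i|i j|f i j tf] /=.
- rewrite (_ : (fun _ => _) = (fun x => a * p.1 x i ord0 + b * q.1 x i ord0)).
    by apply: L2_lin.
  by apply/funext => x; rewrite !mxE.
- rewrite (_ : (fun _ => _) = (fun x => a * p.2 x i j + b * q.2 x i j)).
    by apply: L2_lin.
  by apply/funext => x; rewrite !mxE.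
(* Splitting the integrals needs integrable products: a test function and its derivatives are
   continuous, hence square integrable on the bounded [Om]. *)
have [sf _ _] := tf.
have Lf := continuous_L2 Om oO bO f (smooth_continuous _ sf).
have Ldf := continuous_L2 Om oO bO _ (smooth_partial_continuous _ j sf).
transitivity (a * intO Om (fun x => p.1 x i ord0 * partial j f x) +
              b * intO Om (fun x => q.1 x i ord0 * partial j f x)).
  rewrite -intO_lin; last 2 first.
  - exact: (L2on_prod_integrable mO (Lp1 i) Ldf).
  - exact: (L2on_prod_integrable mO (Lq1 i) Ldf).
  by congr intO; apply/funext => x; rewrite !mxE; ring.
rewrite wp// wq// !mulrN -opprD; congr (- _).
rewrite -intO_lin; last 2 first.
- exact: (L2on_prod_integrable mO (Lp2 i j) Lf).
- exact: (L2on_prod_integrable mO (Lq2 i j) Lf).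
by congr intO; apply/funext => x; rewrite !mxE; ring.
Qed.

Lemma H1_sub p q : H1 Om p -> H1 Om q -> H1 Om (p - q).
Proof. by move=> Hp Hq; rewrite h1_subE; exact: H1_lin. Qed.

Lemma norm0vE (v : vfield R n) : norm0v Om v = nrm2 leb (Om : set T) (fun x => enorm (v x)).
Proof.
rewrite /norm0v /nrm2; congr (Num.sqrt (fine _)).
by apply: eq_integral => x _; rewrite sqr_enorm.
Qed.

Lemma norm0tE (A : tfield R n) : norm0t Om A = nrm2 leb (Om : set T) (fun x => frob (A x)).
Proof.
rewrite /norm0t /nrm2; congr (Num.sqrt (fine _)).
by apply: eq_integral => x _; rewrite sqr_frob.
Qed.

Lemma L2v_enorm (v : vfield R n) : L2v Om v ->
  L2on leb (Om : set T) (fun x => enorm (v x)).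
Proof. by move=> Lv; exact: (L2on_enorm (mu := leb) mO Lv). Qed.

Lemma L2t_frob (A : tfield R n) : L2t Om A ->
  L2on leb (Om : set T) (fun x => frob (A x)).
Proof. by move=> LA; exact: (L2on_frob (mu := leb) mO LA). Qed.

Lemma sqv_fin_num (v : vfield R n) : L2v Om v -> sqv Om v \is a fin_num.
Proof.
move=> /L2v_enorm[_ voo]; rewrite ge0_fin_numE; last first.
  by apply: integral_ge0 => x _; rewrite lee_fin dotvv_ge0.
rewrite (_ : sqv Om v = (\int[leb]_(x in (Om : set T)) (enorm (v x) ^+ 2)%:E)%E)//.
by apply: eq_integral => x _; rewrite sqr_enorm.
Qed.

Lemma sqt_fin_num (A : tfield R n) : L2t Om A -> sqt Om A \is a fin_num.
Proof.
move=> /L2t_frob[_ Aoo]; rewrite ge0_fin_numE; last first.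
  by apply: integral_ge0 => x _; rewrite lee_fin ddotAA_ge0.
rewrite (_ : sqt Om A = (\int[leb]_(x in (Om : set T)) (frob (A x) ^+ 2)%:E)%E)//.
by apply: eq_integral => x _; rewrite sqr_frob.
Qed.

Lemma sqr_norm0v (v : vfield R n) : norm0v Om v ^+ 2 = fine (sqv Om v).
Proof.
by rewrite sqr_sqrtr// fine_ge0// integral_ge0// => x _; rewrite lee_fin dotvv_ge0.
Qed.

Lemma sqr_norm0t (A : tfield R n) : norm0t Om A ^+ 2 = fine (sqt Om A).
Proof.
by rewrite sqr_sqrtr// fine_ge0// integral_ge0// => x _; rewrite lee_fin ddotAA_ge0.
Qed.

Lemma sqr_norm1 (p : h1field R n) : norm1 Om p ^+ 2 = norm0v Om p.1 ^+ 2 + norm0t Om p.2 ^+ 2.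
Proof. by rewrite sqr_sqrtr// addr_ge0// sqr_ge0. Qed.

Lemma norm0v_le_norm1 (p : h1field R n) : norm0v Om p.1 <= norm1 Om p.
Proof.
rewrite -[leLHS]ger0_norm ?sqrtr_ge0// -sqrtr_sqr ler_sqrt ?addr_ge0 ?sqr_ge0//.
by rewrite lerDl sqr_ge0.
Qed.

Lemma norm0t_le_norm1 (p : h1field R n) : norm0t Om p.2 <= norm1 Om p.
Proof.
rewrite -[leLHS]ger0_norm ?sqrtr_ge0// -sqrtr_sqr ler_sqrt ?addr_ge0 ?sqr_ge0//.
by rewrite lerDr sqr_ge0.
Qed.

Lemma norm1_sub (p q : h1field R n) : H1 Om p -> H1 Om q ->
  norm1 Om (p - q) <= norm1 Om p + norm1 Om q.
Proof.
move=> Hp Hq; have [Lp1 Lp2 _] := Hp; have [Lq1 Lq2 _] := Hq.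
have [Ld1 Ld2 _] := H1_sub _ _ Hp Hq.
apply: minkowski_of_young; rewrite ?sqrtr_ge0// => l l0; rewrite !sqr_norm1.
have mv (v : vfield R n) : L2v Om v -> measv (Om : set T) v by move=> Lv i; case: (Lv i).
have mt (A : tfield R n) : L2t Om A -> meast (Om : set T) A.
  by move=> LA i j; case: (LA i j).
have := integral_dotv_sub leb mO l l0 (mv _ Lp1) (mv _ Lq1).
rewrite -[leLHS](fineK (sqv_fin_num _ Ld1)) -[X in (_ * X + _)%E](fineK (sqv_fin_num _ Lp1)).
rewrite -[X in (_ + _ * X)%E](fineK (sqv_fin_num _ Lq1)) lee_fin -!sqr_norm0v => dv.
have := integral_ddot_sub leb mO l l0 (mt _ Lp2) (mt _ Lq2).
rewrite -[leLHS](fineK (sqt_fin_num _ Ld2)) -[X in (_ * X + _)%E](fineK (sqt_fin_num _ Lp2)).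
rewrite -[X in (_ + _ * X)%E](fineK (sqt_fin_num _ Lq2)) lee_fin -!sqr_norm0t => dt.
by apply: le_trans (lerD dv dt) _; lra.
Qed.

End sobolev_fields.

(** * The embedding of H^1 into L^4 and the convection term *)

Section embedding.
Context {R : realType} {n : nat}.
Variable Om : set 'cV[R]_n.
Hypotheses (oO : open Om) (bO : bounded_set Om).
Hypothesis emb4_fin : emb4 Om \is a fin_num.
Local Notation T := (caratheodory_type (@leb_om R n)).
Local Notation mO := (measurable_Om Om oO).

Lemma measurable_enorm (v : h1field R n) : H1 Om v ->
  measurable_fun (Om : set T) (fun x => enorm (v.1 x)).
Proof. by case=> Lv _ _; case: (L2v_enorm Om oO v.1 Lv). Qed.

Lemma nrm2Z (c : R) (f : 'cV[R]_n -> R) : L2on leb (Om : set T) f ->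
  nrm2 leb (Om : set T) (fun x => c * f x) = `|c| * nrm2 leb (Om : set T) f.
Proof.
move=> Lf; rewrite /nrm2 -[`|c|]ger0_norm// -sqrtr_sqr -sqrtrM ?sqr_ge0//.
congr Num.sqrt; rewrite -(RintegralZl _ mO); last exact: L2on_sqr_integrable Lf.
congr fine; apply: eq_integral => x _.
by rewrite exprMn real_normK ?num_real.
Qed.

Definition h1_scale (c : R) (p : h1field R n) : h1field R n :=
  (fun x => c *: p.1 x, fun x => c *: p.2 x).

Lemma H1_scale c p : H1 Om p -> H1 Om (h1_scale c p).
Proof.
move=> Hp; rewrite (_ : h1_scale c p = h1_lin c 0 p p); first exact: H1_lin.
by congr pair; apply/funext => x; rewrite scale0r addr0.
Qed.

Lemma norm1_scale c p : H1 Om p -> norm1 Om (h1_scale c p) = `|c| * norm1 Om p.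
Proof.
move=> [Lp1 Lp2 _]; rewrite /norm1 -[`|c|]ger0_norm// -sqrtr_sqr -sqrtrM ?sqr_ge0//.
congr Num.sqrt; rewrite mulrDr -!exprMn; congr (_ ^+ 2 + _ ^+ 2).
  rewrite !norm0vE -[X in X * _]normr_id -nrm2Z; last exact: L2v_enorm.
  by congr nrm2; apply/funext => x; rewrite enormZ.
rewrite !norm0tE -[X in X * _]normr_id -nrm2Z; last exact: L2t_frob.
by congr nrm2; apply/funext => x; rewrite frobZ.
Qed.

Definition int4 (v : vfield R n) : \bar R :=
  (\int[leb]_(x in (Om : set T)) (enorm (v x) ^+ 4)%:E)%E.

Lemma emb4_ball v : H1 Om v -> norm1 Om v <= 1 -> (int4 v.1 <= (fine (emb4 Om) ^+ 4)%:E)%E.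
Proof.
move=> Hv v1; have I0 : (0 <= int4 v.1)%E.
  by apply: integral_ge0 => x _; rewrite lee_fin exprn_ge0// sqrtr_ge0.
have le_emb : (int4 v.1 `^ 4^-1 <= emb4 Om)%E by apply: ereal_sup_ubound; exists v.
have emb0 : (0 <= emb4 Om)%E by apply: le_trans le_emb; exact: poweR_ge0.
rewrite -[leLHS]poweRe1// -[X in (_ `^ X)%E](@mulVf _ 4)// poweRrM.
apply: (@le_trans _ _ (emb4 Om `^ 4)%E).
  apply: gt0_ler_poweR => //; first by rewrite in_itv/= poweR_ge0 leey.
  by rewrite in_itv/= emb0 leey.
by rewrite -{1}(fineK emb4_fin) poweR_EFin lee_fin powR_mulrn// fine_ge0.
Qed.

(** The scaling [c] is free, instead of being the inverse of [norm1 Om v], so that fields of zero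
    norm are covered as well. *)
Lemma emb4_scale v (c : R) : H1 Om v -> 0 < c -> c * norm1 Om v <= 1 ->
  (int4 v.1 <= ((fine (emb4 Om) / c) ^+ 4)%:E)%E.
Proof.
move=> Hv c0 cv; have := emb4_ball _ (H1_scale c _ Hv).
rewrite norm1_scale// gtr0_norm// => /(_ cv).
have mv4 : measurable_fun (Om : set T) (fun x => (enorm (v.1 x) ^+ 4)%:E).
  by apply/measurable_EFinP; apply: measurable_funX; exact: measurable_enorm.
have v40 x : (Om : set T) x -> (0 <= (enorm (v.1 x) ^+ 4)%:E)%E.
  by move=> _; rewrite lee_fin exprn_ge0// sqrtr_ge0.
have -> : int4 (h1_scale c v).1 = ((c ^+ 4)%:E * int4 v.1)%E.
  rewrite -(ge0_integralZl leb mO mv4 v40); last by rewrite lee_fin exprn_ge0// ltW.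
  by apply: eq_integral => x _; rewrite enormZ exprMn gtr0_norm// EFinM.
by move=> cle; rewrite expr_div_n EFinM lee_pdivlMr ?exprn_gt0// muleC.
Qed.

Lemma L2_sqr_enorm v : H1 Om v -> L2on leb (Om : set T) (fun x => enorm (v.1 x) ^+ 2).
Proof.
move=> Hv; split; first by apply: measurable_funX; exact: measurable_enorm.
have m0 : 0 <= norm1 Om v by rewrite sqrtr_ge0.
have c0 : 0 < (norm1 Om v + 1)^-1 by rewrite invr_gt0 ltr_wpDl.
have := emb4_scale v _ Hv c0; rewrite mulrC ler_pdivrMr ?ltr_wpDl// mul1r lerDl ler01.
move=> /(_ isT) /le_lt_trans -/(_ +oo%E (ltry _)).
rewrite (_ : int4 _ = \int[leb]_(x in (Om : set T)) ((enorm (v.1 x) ^+ 2) ^+ 2)%:E)%E//.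
by apply: eq_integral => x _; rewrite -exprM.
Qed.

Lemma nrm2_sqr_enorm v : H1 Om v ->
  nrm2 leb (Om : set T) (fun x => enorm (v.1 x) ^+ 2) <= c1 Om * norm1 Om v ^+ 2.
Proof.
move=> Hv; set N := nrm2 _ _ _; set m := norm1 Om v; set k := fine (emb4 Om).
have m0 : 0 <= m by rewrite /m sqrtr_ge0.
have le_N c : 0 < c -> c * m <= 1 -> N <= (k / c) ^+ 2.
  move=> c0 cm; rewrite -[leRHS]ger0_norm ?sqr_ge0// -sqrtr_sqr -exprM.
  rewrite ler_sqrt; last by rewrite exprM sqr_ge0.
  rewrite -lee_fin fineK; last first.
    by rewrite ge0_fin_numE ?integral_sqr_ge0//; case: (L2_sqr_enorm _ Hv).
  apply: le_trans (emb4_scale _ _ Hv c0 cm).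
  by rewrite le_eqVlt; apply/orP; left; apply/eqP/eq_integral => x _; rewrite -exprM.
rewrite /c1 -/k -exprMn; have [mE|mN0] := eqVneq m 0; last first.
  have := le_N m^-1; rewrite invrK mulVf// lexx invr_gt0 lt_neqAle eq_sym mN0 m0.
  by apply.
(* When the norm is 0 every [c] is allowed in [le_N], which must force [N = 0]. With
   [c = 1 + 2 * k ^+ 2 / N >= 1] one gets [N * c ^+ 2 >= N * c = N + 2 * k ^+ 2 > k ^+ 2], against
   [le_N]. *)
rewrite mE mulr0 expr0n/= leNgt; apply/negP => N0.
have k20 : 0 <= k ^+ 2 by exact: sqr_ge0.
have c1_ge1 : 1 <= 1 + 2 * k ^+ 2 / N.
  by rewrite lerDl; apply: divr_ge0; [exact: mulr_ge0|exact: ltW].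
have := le_N (1 + 2 * k ^+ 2 / N) (lt_le_trans ltr01 c1_ge1).
rewrite mE mulr0 ler01 => /(_ isT); apply/negP; rewrite -ltNge.
rewrite expr_div_n ltr_pdivrMr; last by rewrite exprn_gt0// (lt_le_trans ltr01).
apply: (@lt_le_trans _ _ (N * (1 + 2 * k ^+ 2 / N))).
  by rewrite mulrDr mulr1 [X in N + X]mulrC divfK ?gt_eqF//; lra.
by rewrite ler_wpM2l ?(ltW N0)// expr2 ler_peMl// (le_trans ler01).
Qed.

(** Cauchy-Schwarz on the squares of the two norms, each of them in L^2 by the embedding. Paired
    with an L^2 gradient this is the Hölder inequality with exponents 2, 4, 4 behind the convection
    bound. *)
Lemma L2_enorm_enorm v w : H1 Om v -> H1 Om w ->
  L2on leb (Om : set T) (fun x => enorm (v.1 x) * enorm (w.1 x)) /\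
  nrm2 leb (Om : set T) (fun x => enorm (v.1 x) * enorm (w.1 x)) <=
    c1 Om * norm1 Om v * norm1 Om w.
Proof.
move=> Hv Hw; have L : L2on leb (Om : set T) (fun x => enorm (v.1 x) * enorm (w.1 x)).
  split; first by apply: measurable_funM; exact: measurable_enorm.
  have /integrableP[_] :=
    L2on_prod_integrable mO (L2_sqr_enorm _ Hv) (L2_sqr_enorm _ Hw).
  apply: le_lt_trans; rewrite le_eqVlt; apply/orP; left; apply/eqP/eq_integral => x _.
  by rewrite /= -exprMn ger0_norm ?sqr_ge0.
split => //; have c10 : 0 <= c1 Om by rewrite sqr_ge0.
have rhs0 : 0 <= c1 Om * norm1 Om v * norm1 Om w.
  by apply: mulr_ge0; [apply: mulr_ge0 => //|]; exact: sqrtr_ge0.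
rewrite -[leRHS]ger0_norm// -sqrtr_sqr ler_sqrt ?sqr_ge0//.
rewrite (_ : fine _ = \int[leb]_(x in (Om : set T))
    (enorm (v.1 x) ^+ 2 * enorm (w.1 x) ^+ 2)); last first.
  by congr fine; apply: eq_integral => x _; rewrite exprMn.
apply: le_trans (cauchy_schwarz mO (L2_sqr_enorm _ Hv) (L2_sqr_enorm _ Hw)) _.
apply: le_trans (ler_pM _ _ (nrm2_sqr_enorm _ Hv) (nrm2_sqr_enorm _ Hw)) _;
  rewrite ?sqrtr_ge0//.
by rewrite le_eqVlt; apply/orP; left; apply/eqP; ring.
Qed.

Lemma convection_integrable (A : tfield R n) w v : L2t Om A -> H1 Om w -> H1 Om v ->
  leb.-integrable (Om : set T) (EFin \o (fun x => dotv (A x *m w.1 x) (v.1 x))).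
Proof.
move=> LA Hw Hv; have [L _] := L2_enorm_enorm _ _ Hw Hv.
apply: (integrable_le mO) (L2on_prod_integrable mO (L2t_frob Om oO A LA) L); last first.
  by move=> x _; exact: normr_dotv_mulmx.
have mA : meast (Om : set T) A by move=> i j; case: (LA i j).
have mw : measv (Om : set T) w.1 by move=> i; case: Hw => Lw _ _; case: (Lw i).
have mv : measv (Om : set T) v.1 by move=> i; case: Hv => Lv _ _; case: (Lv i).
exact: measurable_dotv (measv_mulmx mA mw) mv.
Qed.

Lemma convection_bound (A : tfield R n) w v : L2t Om A -> H1 Om w -> H1 Om v ->
  `|intO Om (fun x => dotv (A x *m w.1 x) (v.1 x))| <=
  c1 Om * norm0t Om A * norm1 Om w * norm1 Om v.
Proof.
move=> LA Hw Hv; have [L Lle] := L2_enorm_enorm _ _ Hw Hv.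
have LAf := L2t_frob Om oO A LA.
apply: le_trans (le_normr_Rintegral mO (convection_integrable _ _ _ LA Hw Hv)) _.
apply: (@le_trans _ _ (\int[leb]_(x in (Om : set T))
    (frob (A x) * (enorm (w.1 x) * enorm (v.1 x))))).
  apply: (le_Rintegral mO).
  - exact: integrable_abse (convection_integrable _ _ _ LA Hw Hv).
  - exact: (L2on_prod_integrable mO LAf L).
  - by move=> x _; exact: normr_dotv_mulmx.
apply: le_trans (cauchy_schwarz mO LAf L) _; rewrite -norm0tE.
apply: le_trans (ler_wpM2l _ Lle) _; first by rewrite sqrtr_ge0.
by rewrite le_eqVlt; apply/orP; left; apply/eqP; ring.
Qed.

End embedding.

(** * Diffusion form and traces *)

Section diffusion_form.
Context {R : realType} {n : nat}.
Variables (Om : set 'cV[R]_n) (K : tfield R n) (M k0 : R).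
Local Notation T := (caratheodory_type (@leb_om R n)).
Hypotheses (oO : open Om)
  (mK : forall i j, measurable_fun (Om : set T) (fun x => K x i j))
  (KM : {ae leb, forall x : 'cV[R]_n, Om x -> forall i j, `|K x i j| <= M})
  (Kd : {ae leb, forall x : 'cV[R]_n, Om x -> is_diag_mx (K x) /\
         forall y, k0 * enorm y ^+ 2 <= dotv (K x *m y) y}).
Local Notation mO := (measurable_Om Om oO).
Implicit Types A B : tfield R n.

Lemma measurable_diffusion A B : L2t Om A -> L2t Om B ->
  measurable_fun (Om : set T) (fun x => ddot (K x *m A x) (B x)).
Proof.
move=> LA LB; have mA : meast (Om : set T) A by move=> i j; case: (LA i j).
have mB : meast (Om : set T) B by move=> i j; case: (LB i j).
exact: measurable_ddot (meast_mulmx mK mA) mB.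
Qed.

Lemma diffusion_ae_bound A B : {ae leb, forall x : 'cV[R]_n, Om x ->
  `|ddot (K x *m A x) (B x)| <= `|M| * (frob (A x) * frob (B x))}.
Proof.
apply: (ae_impl2 leb _ KM Kd) => x xM xd Ox; have [diagK _] := xd Ox.
apply: le_trans (normr_ddot_le_frob _ _) _; rewrite mulrA ler_wpM2r ?sqrtr_ge0//.
by apply: frob_diag_mulmx => //; exact: xM.
Qed.

Lemma frob_frob_integrable (c : R) A B : L2t Om A -> L2t Om B ->
  leb.-integrable (Om : set T) (EFin \o (fun x => c * (frob (A x) * frob (B x)))).
Proof.
move=> /(L2t_frob Om oO) LA /(L2t_frob Om oO) LB.
have := integrable_lin mO c 0 (L2on_prod_integrable mO LA LB) (L2on_prod_integrable mO LA LB).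
by apply: (eq_integrable mO) => x _; rewrite /= mul0r addr0.
Qed.

Lemma diffusion_integrable A B : L2t Om A -> L2t Om B ->
  leb.-integrable (Om : set T) (EFin \o (fun x => ddot (K x *m A x) (B x))).
Proof.
move=> LA LB; apply: (ae_le_integrable mO) (frob_frob_integrable `|M| _ _ LA LB).
- exact: measurable_diffusion.
- by move=> x _; rewrite !mulr_ge0// sqrtr_ge0.
- exact: diffusion_ae_bound.
Qed.

Lemma diffusion_le A B : L2t Om A -> L2t Om B ->
  intO Om (fun x => ddot (K x *m A x) (B x)) <= `|M| * (norm0t Om A * norm0t Om B).
Proof.
move=> LA LB; have LAf := L2t_frob Om oO _ LA; have LBf := L2t_frob Om oO _ LB.
have frob_int := L2on_prod_integrable mO LAf LBf.
apply: (@le_trans _ _ (`|M| * intO Om (fun x => frob (A x) * frob (B x)))); last first.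
  by rewrite ler_wpM2l// !norm0tE; exact: (cauchy_schwarz mO LAf LBf).
rewrite -subr_ge0.
have -> : `|M| * intO Om (fun x => frob (A x) * frob (B x)) -
    intO Om (fun x => ddot (K x *m A x) (B x)) =
  intO Om (fun x => `|M| * (frob (A x) * frob (B x)) + (-1) * ddot (K x *m A x) (B x)).
  by rewrite intO_lin ?mulN1r//; exact: diffusion_integrable.
apply: (Rintegral_ae_ge0 mO).
  apply: measurable_lin (measurable_diffusion A B LA LB).
  exact: measurable_funM (proj1 LAf) (proj1 LBf).
have ae_bound := diffusion_ae_bound A B.
apply: (ae_impl2 leb _ ae_bound ae_bound) => x xM _ Ox; have := xM Ox.
by rewrite mulN1r subr_ge0; apply: le_trans; exact: ler_norm.
Qed.

Lemma diffusion_coercive A : L2t Om A ->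
  k0 * norm0t Om A ^+ 2 <= intO Om (fun x => ddot (K x *m A x) (A x)).
Proof.
move=> LA; have LAf := L2t_frob Om oO _ LA.
rewrite norm0tE sqr_nrm2 -subr_ge0.
have -> : intO Om (fun x => ddot (K x *m A x) (A x)) -
    k0 * \int[leb]_(x in (Om : set T)) (frob (A x) ^+ 2) =
  intO Om (fun x => 1 * ddot (K x *m A x) (A x) + (- k0) * frob (A x) ^+ 2).
  rewrite intO_lin ?mul1r ?mulNr//; first exact: diffusion_integrable.
  exact: L2on_sqr_integrable.
apply: (Rintegral_ae_ge0 mO).
  apply: measurable_lin (measurable_diffusion A A LA LA) _.
  exact: measurable_funX (proj1 LAf).
apply: (ae_impl2 leb _ Kd Kd) => x xd _ Ox; have [_ coerc] := xd Ox.
rewrite mul1r mulNr subr_ge0 sqr_frob ddot_mulmx_col ddot_col mulr_sumr.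
by apply: ler_sum => j _; exact: coerc.
Qed.

End diffusion_form.

Section traces.
Context {R : realType} {n : nat}.

Lemma foldr_partial_sub (f g : 'cV[R]_n -> R) s : smooth f -> smooth g ->
  foldr partial (f \- g) s = foldr partial f s \- foldr partial g s.
Proof.
move=> sf sg; elim: s => //= j s ->; apply/funext => x.
by rewrite /partial deriveB//; [case: (sf s)|case: (sg s)].
Qed.

Lemma smooth_sub (f g : 'cV[R]_n -> R) : smooth f -> smooth g -> smooth (f \- g).
Proof.
move=> sf sg s /=; rewrite foldr_partial_sub//.
have [cf df] := sf s; have [cg dg] := sg s; split => [x|x j].
  by apply: continuousB; [exact: cf|exact: cg].
by apply: derivableB; [exact: df|exact: dg].
Qed.

Lemma smoothv_sub (v w : vfield R n) : smoothv v -> smoothv w -> smoothv (v \- w).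
Proof.
move=> sv sw i; rewrite (_ : (fun _ => _) = (fun x => v x i ord0) \- (fun x => w x i ord0)).
  exact: smooth_sub.
by apply/funext => x; rewrite !mxE.
Qed.

Lemma cgrad_sub (v w : vfield R n) x : smoothv v -> smoothv w ->
  cgrad (v \- w) x = cgrad v x - cgrad w x.
Proof.
move=> sv sw; apply/matrixP => i j; rewrite !mxE.
have := foldr_partial_sub _ _ [:: j] (sv i) (sw i) => /= /(congr1 (@^~ x)) /= <-.
rewrite (_ : (fun y => (v \- w) y i ord0) = (fun y => v y i ord0) \- (fun y => w y i ord0))//.
by apply/funext => y; rewrite !mxE.
Qed.

Lemma cvge0_le_lin (a b : R) (u v w : nat -> \bar R) :
  u @ \oo --> 0%E -> v @ \oo --> 0%E ->
  (forall m, 0 <= w m)%E -> (forall m, w m <= a%:E * u m + b%:E * v m)%E ->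
  w @ \oo --> 0%E.
Proof.
move=> u0 v0 w0 wle.
apply: (@squeeze_cvge _ _ _ _ (fun=> 0%E) _ (fun m => a%:E * u m + b%:E * v m)%E).
- by apply: nearW => m; rewrite w0 wle.
- exact: cvg_cst.
- rewrite -[X in _ --> X](_ : (a%:E * 0 + b%:E * 0)%E = 0%E); last by rewrite !mule0 adde0.
  by apply: cvgeD; [rewrite !mule0|apply: cvgeZl|apply: cvgeZl].
Qed.

Lemma subr_subACA {V : zmodType} (a b c e : V) : a - b - (c - e) = a - c - (b - e).
Proof. by rewrite !opprD addrACA. Qed.

Lemma sqv_ge0 (Om : set 'cV[R]_n) v : (0 <= sqv Om v)%E.
Proof. by apply: integral_ge0 => x _; rewrite lee_fin dotvv_ge0. Qed.

Lemma sqt_ge0 (Om : set 'cV[R]_n) A : (0 <= sqt Om A)%E.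
Proof. by apply: integral_ge0 => x _; rewrite lee_fin ddotAA_ge0. Qed.

(** The approximating sequences are subtracted; Young with parameter 1 bounds the squared distances
    by twice the sum of the given ones, which is enough for convergence to 0. *)
Lemma trace_sub (Om S : set 'cV[R]_n) (p q : h1field R n) (g h : vfield R n) :
  open Om -> measurable (S : set (caratheodory_type surf_om)) ->
  H1 Om p -> H1 Om q -> trace Om S p g -> trace Om S q h -> trace Om S (p - q) (g \- h).
Proof.
move=> oO mS [Lp1 Lp2 _] [Lq1 Lq2 _] [mg goo [w sw [wp wg]]] [mh hoo [z sz [zq zh]]].
have mO := measurable_Om Om oO.
pose TS := caratheodory_type (@surf_om R n).
have msurf (v : vfield R n) : smoothv v -> measv (S : set TS) v.
  by move=> sv i; exact: (continuous_caratheodory_measurable surf_om S _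
    open_surf_measurable mS (smooth_continuous _ (sv i))).
pose TL := caratheodory_type (@leb_om R n).
have mv (v : vfield R n) : L2v Om v -> measv (Om : set TL) v by move=> Lv i; case: (Lv i).
have mt (A : tfield R n) : L2t Om A -> meast (Om : set TL) A.
  by move=> LA i j; case: (LA i j).
have mw (v : vfield R n) : smoothv v -> measv (Om : set TL) v.
  by move=> sv i; exact: (continuous_measurable Om oO _ (smooth_continuous _ (sv i))).
have mgw (v : vfield R n) : smoothv v -> meast (Om : set TL) (cgrad v).
  move=> sv i j; rewrite (_ : (fun _ => _) = partial j (fun y => v y i ord0)).
    by apply: continuous_measurable => //; exact: smooth_partial_continuous.
  by apply/funext => x; rewrite mxE.
have surf0 (v : vfield R n) : (0 <= surf_sq S v)%E.
  by apply: integral_ge0 => x _; rewrite lee_fin dotvv_ge0.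
split.
- exact: measv_sub.
- apply: le_lt_trans (integral_dotv_sub surf mS 1 ltr01 mg mh) _.
  by rewrite lte_add_pinfty// lte_mul_pinfty// ?surf0// lee_fin ?invr1 addr_ge0.
- exists (fun m => w m \- z m) => [m|]; first exact: smoothv_sub.
  split.
  + have sqvle m : (sqv Om ((p - q).1 - (w m \- z m))%R <=
        (1 + 1)%:E * sqv Om (p.1 - w m)%R + (1 + 1^-1)%:E * sqv Om (q.1 - z m)%R)%E.
      have := integral_dotv_sub leb mO 1 ltr01
        (measv_sub (mv _ Lp1) (mw _ (sw m))) (measv_sub (mv _ Lq1) (mw _ (sz m))).
      apply: le_trans; rewrite le_eqVlt; apply/orP; left; apply/eqP.
      by apply: eq_integral => x _; rewrite -(subr_subACA (p.1 x) (q.1 x)).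
    have sqtle m : (sqt Om ((p - q).2 - cgrad (w m \- z m))%R <=
        (1 + 1)%:E * sqt Om (p.2 - cgrad (w m))%R +
        (1 + 1^-1)%:E * sqt Om (q.2 - cgrad (z m))%R)%E.
      have := integral_ddot_sub leb mO 1 ltr01
        (meast_sub (mt _ Lp2) (mgw _ (sw m))) (meast_sub (mt _ Lq2) (mgw _ (sz m))).
      apply: le_trans; rewrite le_eqVlt; apply/orP; left; apply/eqP.
      apply: eq_integral => x _.
      by rewrite -(subr_subACA (p.2 x) (q.2 x)) -cgrad_sub.
    have sqdistle m : (sqdist1 Om (p - q)%R (w m \- z m)%R <=
        (1 + 1)%:E * sqdist1 Om p (w m) + (1 + 1^-1)%:E * sqdist1 Om q (z m))%E.
      apply: le_trans (leeD (sqvle m) (sqtle m)) _.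
      rewrite /sqdist1 (ge0_muleDr (1 + 1)%:E (sqv_ge0 _ _) (sqt_ge0 _ _)).
      by rewrite (ge0_muleDr (1 + 1^-1)%:E (sqv_ge0 _ _) (sqt_ge0 _ _)) addeACA.
    apply: (cvge0_le_lin _ _ _ _ _ wp zq _ sqdistle) => m.
    by rewrite adde_ge0 ?sqv_ge0 ?sqt_ge0.
  + have surfle m : (surf_sq S ((w m \- z m) - (g \- h))%R <=
        (1 + 1)%:E * surf_sq S (w m - g)%R + (1 + 1^-1)%:E * surf_sq S (z m - h)%R)%E.
      have := integral_dotv_sub surf mS 1 ltr01
        (measv_sub (msurf _ (sw m)) mg) (measv_sub (msurf _ (sz m)) mh).
      apply: le_trans; rewrite le_eqVlt; apply/orP; left; apply/eqP.
      by apply: eq_integral => x _; rewrite -(subr_subACA (w m x) (z m x)).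
    exact: (cvge0_le_lin _ _ _ _ _ wg zh (fun m => surf0 _) surfle).
Qed.

End traces.

(** * Error estimate *)

(** [P], [E], [H], [X] stand for the H^1 norms of psi, phi - phi_h, eta and u - u_h; [p], [e], [h]
    are the L^2 norms of the gradients of the first three fields, and [np] that of phi. Dividing the
    energy bound by [P] gives [al * P <= mm * H + al * E / 2 + al * X / 2]; then [E <= H + P]
    absorbs half of [E], and the factor 2 restores the coefficient of [X] to 1. *)
Lemma absorb_error {R : realType} (al mm c r P E H X p h e np nphi nuh : R) :
  0 < al -> 0 <= mm -> 0 <= c -> 0 <= P -> 0 <= E -> 0 <= H -> 0 <= X ->
  0 <= p <= P -> 0 <= h <= H -> 0 <= e <= E -> 0 <= np <= nphi -> 0 <= nuh ->
  nphi <= r -> nuh <= r -> r * (c / al) <= 2^-1 ->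
  al * P ^+ 2 <= mm * (h * p) + (c * e * nuh * P + c * np * X * P) ->
  E <= H + P ->
  E <= 2 * (1 + mm / al) * H + X.
Proof.
move=> al0 mm0 c0 P0 E0 H0 X0 /andP[p0 pP] /andP[h0 hH] /andP[e0 eE] /andP[np0 npr] nuh0.
move=> nphir nuhr; rewrite mulrA ler_pdivrMr// => rc energy tri.
have r0 : 0 <= r by exact: le_trans nuhr.
have cr z : 0 <= z -> c * r * z <= 2^-1 * al * z.
  by move=> z0; rewrite ler_wpM2r// mulrC.
have le1 : mm * (h * p) <= mm * H * P by rewrite -mulrA ler_wpM2l// ler_pM.
have le2 : c * e * nuh <= 2^-1 * al * E.
  apply: le_trans (cr _ E0); rewrite -!mulrA ler_wpM2l// mulrC ler_pM//.
have le3 : c * np * X <= 2^-1 * al * X.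
  apply: le_trans (cr _ X0); rewrite ler_wpM2r// ler_wpM2l//; exact: le_trans nphir.
have alP : al * P <= mm * H + 2^-1 * al * E + 2^-1 * al * X.
  have [->|P_gt0] := eqVneq P 0.
    by rewrite mulr0 !addr_ge0 ?mulr_ge0// ltW.
  have {}P_gt0 : 0 < P by rewrite lt_neqAle eq_sym P_gt0.
  rewrite -(ler_pM2r P_gt0) (_ : al * P * P = al * P ^+ 2); last by rewrite expr2 mulrA.
  apply: le_trans energy _.
  rewrite -addrA mulrDl lerD// mulrDl lerD// ler_wpM2r//.
rewrite -(ler_pM2l al0).
have -> : al * (2 * (1 + mm / al) * H + X) = 2 * (al * H) + 2 * (mm * H) + al * X.
  by field; rewrite gt_eqF.
have := ler_wpM2l (ltW al0) tri; rewrite mulrDr; lra.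
Qed.

(** Here [e] and [c] are the convection integrals of the continuous and the discrete equation, and
    [s] is their difference. *)
Lemma subr_balance {V : zmodType} (x y c e s : V) :
  x - e = y - c -> s + c = e -> x = y + s.
Proof. by move=> /(canRL (subrK e)) -> <-; rewrite -addrA; congr (_ + _); rewrite addrCA addNr addr0. Qed.

Section error_estimate.
Context {R : realType} {n : nat}.
Variable Om : set 'cV[R]_n.
Hypotheses (oO : open Om) (bO : bounded_set Om).
Local Notation T := (caratheodory_type (@leb_om R n)).
Local Notation mO := (measurable_Om Om oO).

Lemma intOD (f g : 'cV[R]_n -> R) :
  leb.-integrable (Om : set T) (EFin \o f) -> leb.-integrable (Om : set T) (EFin \o g) ->
  intO Om f + intO Om g = intO Om (fun x => f x + g x).
Proof. by move=> fi gi; symmetry; exact: (RintegralD mO fi gi). Qed.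

Lemma Pk_sub k (f g : 'cV[R]_n -> R) : Pk k f -> Pk k g -> Pk k (f \- g).
Proof.
move=> [a fa] [b gb]; exists (fun m => a m - b m) => x.
by rewrite /= fa gb -sumrB; apply: eq_bigr => m _; rewrite mulrBl.
Qed.

Lemma Hphi_sub (Th : seq (simplex R n.+1 n)) k p q :
  Hphi Om Th k p -> Hphi Om Th k q -> Hphi Om Th k (p - q).
Proof.
move=> [Hp cp Pp] [Hq cq Pq]; split; first exact: H1_sub.
  by move=> x; apply: continuousB; [exact: cp|exact: cq].
move=> a aT i; have [f Pf fE] := Pp a aT i; have [g Pg gE] := Pq a aT i.
by exists (f \- g) => [|x ax]; [exact: Pk_sub|rewrite !mxE fE// gE].
Qed.

Lemma norm1_le_norm1s e (p : h1field R n) : norm1 Om p <= norm1s Om e p.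
Proof.
have s0 : 0 <= fine (slobo Om e p.2).
  apply/fine_ge0/integral_ge0 => x _; apply: integral_ge0 => y _.
  by rewrite lee_fin divr_ge0 ?ddotAA_ge0 ?powR_ge0.
rewrite -[leLHS]ger0_norm ?sqrtr_ge0// -sqrtr_sqr ler_sqrt ?addr_ge0 ?sqr_ge0//.
by rewrite lerDl.
Qed.

Lemma norm1_le_normHH (xi : state R n) : norm1 Om xi.2 <= normHH Om xi.
Proof.
rewrite -[leLHS]ger0_norm ?sqrtr_ge0// -sqrtr_sqr ler_sqrt ?addr_ge0 ?sqr_ge0//.
by rewrite lerDr addr_ge0 ?sqr_ge0.
Qed.

Lemma distHH_ge0 (xi : state R n) X : X !=set0 -> 0 <= distHH Om xi X.
Proof.
move=> [eta Xeta]; apply: lb_le_inf; first by exists (normHH Om (xi - eta)), eta.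
by move=> _ [z _ <-]; exact: sqrtr_ge0.
Qed.

Variable D : model R n.
Variables (M k0 cgp r : R).
Hypotheses (emb4_fin : emb4 Om \is a fin_num)
  (mK : forall i j, measurable_fun (Om : set T) (fun x => KK D x i j))
  (KM : {ae leb, forall x : 'cV[R]_n, Om x -> forall i j, `|KK D x i j| <= M})
  (Kd : {ae leb, forall x : 'cV[R]_n, Om x -> is_diag_mx (KK D x) /\
         forall y, k0 * enorm y ^+ 2 <= dotv (KK D x *m y) y})
  (k0_gt0 : 0 < k0) (cgp_gt0 : 0 < cgp).

(** The convection difference is split as (grad phi) u - (grad phi_h) u_h = grad (phi - phi_h) u_h +
    (grad phi)(u - u_h), so that each error is multiplied by a quantity bounded by [r]: the discrete
    velocity or the continuous temperature. *)
Lemma Cform_residual phi phih Iphi u uh psi : H1 Om phi -> H1 Om phih -> H1 Om Iphi ->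
  H1 Om u -> H1 Om uh -> H1 Om psi ->
  Cform Om D phi psi = Gform Om u phi psi ->
  Cform Om D phih psi = Gform Om uh phih psi ->
  Cform Om D (phih - Iphi) psi = Cform Om D (phi - Iphi) psi +
    (intO Om (fun x => dotv ((phi - phih).2 x *m uh.1 x) (psi.1 x)) +
     intO Om (fun x => dotv (phi.2 x *m (u - uh).1 x) (psi.1 x))).
Proof.
move=> Hphi Hphih HI Hu Huh Hpsi; rewrite /Gform => phi_eq phih_eq.
have [_ Lphi _] := Hphi; have [_ Lphih _] := Hphih; have [_ Lpsi _] := Hpsi.
have [_ Ld _] := H1_sub Om oO bO _ _ Hphi HI.
have [_ Le _] := H1_sub Om oO bO _ _ Hphi Hphih.
have [_ Lpsih _] := H1_sub Om oO bO _ _ Hphih HI.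
have He := H1_sub Om oO bO _ _ Hu Huh.
have bint A w (LA : L2t Om A) (Hw : H1 Om w) :=
  convection_integrable Om oO bO emb4_fin A w psi LA Hw Hpsi.
have cint A (LA : L2t Om A) :=
  diffusion_integrable Om (KK D) M k0 oO mK KM Kd A psi.2 LA Lpsi.
have b1 := bint _ _ Le Huh; have b2 := bint _ _ Lphi He.
have b3 := bint _ _ Lphi Hu; have b4 := bint _ _ Lphih Huh.
have flux : intO Om (fun x => dotv ((phi - phih).2 x *m uh.1 x) (psi.1 x)) +
    intO Om (fun x => dotv (phi.2 x *m (u - uh).1 x) (psi.1 x)) +
    intO Om (fun x => dotv (phih.2 x *m uh.1 x) (psi.1 x)) =
    intO Om (fun x => dotv (phi.2 x *m u.1 x) (psi.1 x)).
  rewrite (intOD _ _ b1 b2) intOD//; last by have := integrableD mO b1 b2.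
  congr intO; apply/funext => x /=; rewrite mulmxBl mulmxBr !dotvBl; ring.
have diffusion : Cform Om D (phih - Iphi) psi + Cform Om D phi psi =
    Cform Om D (phi - Iphi) psi + Cform Om D phih psi.
  refine (etrans (intOD _ _ (cint _ Lpsih) (cint _ Lphi))
    (etrans _ (esym (intOD _ _ (cint _ Ld) (cint _ Lphih))))).
  congr intO; apply/funext => x /=; rewrite !mulmxBr !ddotBl; ring.
rewrite phi_eq phih_eq in diffusion.
exact: subr_balance diffusion flux.
Qed.

Lemma temperature_error phi phih Iphi u uh :
  H1 Om phi -> H1 Om phih -> H1 Om Iphi -> H1 Om u -> H1 Om uh ->
  Cform Om D phi (phih - Iphi) = Gform Om u phi (phih - Iphi) ->
  Cform Om D phih (phih - Iphi) = Gform Om uh phih (phih - Iphi) ->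
  norm1 Om (phih - Iphi) <= cgp * norm0t Om (phih - Iphi).2 ->
  norm1 Om phi <= r -> norm1 Om uh <= r ->
  r * (c1 Om / (k0 / cgp ^+ 2)) <= 2^-1 ->
  norm1 Om (phi - phih) <=
    2 * (1 + `|M| / (k0 / cgp ^+ 2)) * norm1 Om (phi - Iphi) + norm1 Om (u - uh).
Proof.
move=> Hphi Hphih HI Hu Huh phi_eq phih_eq poincare phir uhr small.
have Hpsi := H1_sub Om oO bO _ _ Hphih HI; have [_ Lpsi _] := Hpsi.
have Heta := H1_sub Om oO bO _ _ Hphi HI; have [_ Leta _] := Heta.
have He := H1_sub Om oO bO _ _ Hphi Hphih; have [_ Le _] := He.
have [_ Lphi _] := Hphi; have Hdu := H1_sub Om oO bO _ _ Hu Huh.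
have residual := Cform_residual _ _ _ _ _ _ Hphi Hphih HI Hu Huh Hpsi phi_eq phih_eq.
have coercive := diffusion_coercive Om (KK D) M k0 oO mK KM Kd _ Lpsi.
have continuity := diffusion_le Om (KK D) M k0 oO mK KM Kd _ _ Leta Lpsi.
have conv1 := convection_bound Om oO bO emb4_fin _ _ _ Le Huh Hpsi.
have conv2 := convection_bound Om oO bO emb4_fin _ _ _ Lphi Hdu Hpsi.
have triangle : norm1 Om (phi - phih) <= norm1 Om (phi - Iphi) + norm1 Om (phih - Iphi).
  apply: le_trans (norm1_sub Om oO bO _ _ Heta Hpsi).
  by rewrite opprB addrA subrK.
rewrite /Cform in residual; rewrite residual in coercive.
have {}conv1 := le_trans (ler_norm _) conv1.
have {}conv2 := le_trans (ler_norm _) conv2.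
have nt_le p : 0 <= norm0t Om p.2 <= norm1 Om p.
  by rewrite norm0t_le_norm1 andbT; exact: sqrtr_ge0.
have n10 p : 0 <= norm1 Om p by exact: sqrtr_ge0.
have c10 : 0 <= c1 Om by exact: sqr_ge0.
have al0 : 0 < k0 / cgp ^+ 2 by rewrite divr_gt0// exprn_gt0.
apply: (absorb_error (k0 / cgp ^+ 2) `|M| (c1 Om) r (norm1 Om (phih - Iphi)) _ _ _
  _ _ _ _ _ _ al0 (normr_ge0 M) c10 (n10 _) (n10 _) (n10 _) (n10 _)
  (nt_le (phih - Iphi)) (nt_le (phi - Iphi)) (nt_le (phi - phih)) (nt_le phi) (n10 uh)
  phir uhr small _ triangle).
apply: le_trans (le_trans coercive (lerD continuity (lerD conv1 conv2))).
(* Coercivity controls the gradient of psi only; the Poincaré inequality turns it into the full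
   norm, whence the constant [k0 / cgp ^+ 2]. *)
rewrite mulrAC ler_pdivrMr ?exprn_gt0// -mulrA ler_wpM2l ?(ltW k0_gt0)//.
rewrite mulrC -exprMn ler_pXn2r ?nnegrE//.
by rewrite mulr_ge0 ?(ltW cgp_gt0)//; exact: sqrtr_ge0.
Qed.

End error_estimate.

(** Inserting [E <= C * H + x] and [x <= X] leaves half of [X] on the right, so
    [X <= 2 * CST * d + C * H]. Since [E <= C * H + X], the sum is at most
    [4 * CST * d + 3 * C * H], which is where the final constant comes from. *)
Lemma absorb_total {R : realType} (CST a t u Ch CA r C X E d H x : R) :
  0 <= CST -> 0 <= a -> 0 <= t -> 0 <= u -> 0 <= r -> 0 <= CA -> 0 <= C ->
  0 <= d -> 0 <= H -> 0 <= x -> t + u <= Ch * a * r ->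
  CST * (1 + r * Ch + r * CA) * a <= 2^-1 ->
  X <= CST * (d + a * E + t * E + u * x) -> E <= C * H + x -> x <= X ->
  X + E <= (4 * CST + 3 * C) * (d + H).
Proof.
move=> CST0 a0 t0 u0 r0 CA0 C0 d0 H0 x0 tu small strang temp xX.
have coef : CST * (a + t + u) <= 2^-1.
  apply: le_trans small; rewrite -mulrA ler_wpM2l//.
  have : 0 <= r * CA * a by rewrite !mulr_ge0.
  lra.
have CH0 : 0 <= C * H by exact: mulr_ge0.
have coef' : CST * (a + t) <= 2^-1.
  by apply: le_trans coef; rewrite ler_wpM2l// lerDl.
have le1 : CST * (a * E + t * E + u * x) <= 2^-1 * (C * H) + 2^-1 * X.
  apply: (@le_trans _ _ (CST * (a + t) * (C * H) + CST * (a + t + u) * x)).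
    rewrite -!mulrA -mulrDr ler_wpM2l//.
    have := ler_wpM2l (addr_ge0 a0 t0) temp; rewrite mulrDr; lra.
  apply: lerD; first exact: ler_wpM2r.
  by apply: le_trans (ler_wpM2r x0 coef) _; rewrite ler_wpM2l// invr_ge0.
have Xle : X <= 2 * (CST * d) + C * H.
  move: strang; rewrite -!addrA [a * E + _]addrA mulrDr => strang; lra.
have CdH : 0 <= CST * H by exact: mulr_ge0.
have Cd : 0 <= C * d by exact: mulr_ge0.
rewrite !mulrDr !mulrDl; lra.
Qed.

Theorem theorem5p4 (R : realType) (n : nat)
    (Om GD GN : set 'cV[R]_n)
    (D : model R n) (nu1 nu2 Lnu k0 : R) (phiD : vfield R n) (E : h1field R n)
    (alphaO cgp eps r : R) (Chat : R -> R) (CST : R)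
    (k : nat) (S : set R) (T : R -> seq (simplex R n.+1 n))
    (I : R -> h1field R n -> h1field R n)
    (xi : state R n) (phi : h1field R n)
    (xih : R -> state R n) (phih : R -> h1field R n) :
  n = 2%N \/ n = 3%N ->
  polyhedral_domain Om ->
  GD `<=` bdry Om -> GN `<=` bdry Om -> GD `&` GN = set0 ->
  measurable (GD : set (caratheodory_type surf_om)) -> (0 < surf GD)%E ->
  bdry Om = closure GD `|` closure GN ->
  data_ok Om D nu1 nu2 Lnu k0 ->
  Hhalf Om GD phiD ->
  H1 Om E -> trace Om GD E phiD -> norm1 Om E = norm_half Om GD phiD ->
  kappa_ok D nu1 nu2 ->
  emb4 Om \is a fin_num ->
  0 < alphaO -> elliptic Om D alphaO ->
  0 < cgp -> (forall psi, H1D Om GD psi -> norm1 Om psi <= cgp * norm0t Om psi.2) ->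
  (forall h, S h -> [/\ 0 < h, triangulation Om (T h), fits_boundary Om GD GN (T h)
                      & mesh_size (T h) h]) ->
  regular_family S T ->
  (forall h, S h -> scott_zhang Om GD (T h) k (I h)) ->
  0 < r < r0 Om D alphaO ->
  0 < eps < 1 -> (n = 3%N -> 2^-1 <= eps) ->
  0 < Chat r -> regularity Om D eps r (Chat r) ->
  continuous_sol Om D GD phiD xi phi ->
  Wball Om r xi.2 phi ->
  (forall h, S h -> discrete_sol Om D GD (T h) k (I h E) (xih h) (phih h)) ->
  (forall h, S h -> Wballh Om (T h) k r (xih h).2 (phih h)) ->
  0 < CST ->
  (forall h, S h -> normHH Om (xi - xih h) <=
     CST * (distHH Om xi (HHh Om (T h) k)
            + enorm (alp D) * enorm (grav D) * norm1 Om (phi - phih h)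
            + norms Om eps xi.1.1 * norm1 Om (phi - phih h)
            + norm1 Om xi.2 * norm1 Om (xi.2 - (xih h).2))) ->
  let alphat := k0 / cgp ^+ 2 in
  let C1 := CST * (1 + r * Chat r + r * CA D alphaO) in
  r * (c1 Om / alphat) <= 2^-1 ->
  C1 * enorm (alp D) * enorm (grav D) <= 2^-1 ->
  exists2 Cstar : R, 0 < Cstar & forall h, S h ->
    normHH Om (xi - xih h) + norm1 Om (phi - phih h) <=
      Cstar * (distHH Om xi (HHh Om (T h) k) + norm1 Om (phi - I h phi)).
Proof.
move=> _ [[oO _ _ bO] _] _ _ _ mGD _ _ [[_ _ _ _ k0_gt0] [mK [M KM] Kd]] _ HE tE _ _.
move=> emb4_fin alphaO_gt0 _ cgp_gt0 poincare _ _ SZ /andP[r_gt0 _] _ _ Chat_gt0 reg sol.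
move=> Wphi dsol dW CST_gt0 strang alphat C1 small_r small_data.
have [HHxi Hphi tphi flow_eq heat_eq] := sol; have [[Hu _] _ ur] := Wphi.
have n10 p : 0 <= norm1 Om p by exact: sqrtr_ge0.
have en0 (v : 'cV[R]_n) : 0 <= enorm v by exact: sqrtr_ge0.
have phir : norm1 Om phi <= r by apply: le_trans ur; rewrite lerDr.
(* The flow equation says that [xi] is the value of the solution operator at its own velocity and
   temperature, so the regularity assumption applies to it. *)
have [_ _ _ regb] := reg _ _ _ Wphi (conj HHxi flow_eq).
set a := enorm (alp D) * enorm (grav D).
have a_ge0 : 0 <= a by exact: mulr_ge0.
have tu_le : norms Om eps xi.1.1 + norm1 Om xi.2 <= Chat r * a * r.
  apply: (@le_trans _ _ (norms Om eps xi.1.1 + norms Om eps xi.1.2.1 + norm1s Om eps xi.2)).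
    by rewrite -addrA lerD2l (le_trans (norm1_le_norm1s Om eps _))// lerDr sqrtr_ge0.
  apply: le_trans regb _; rewrite -[Chat r * _ * _]mulrA ler_wpM2l ?mulr_ge0 ?(ltW Chat_gt0)//.
  exact: le_trans (norm0v_le_norm1 _ _) phir.
have alphat_gt0 : 0 < alphat by rewrite divr_gt0// exprn_gt0.
(* The constant of the temperature estimate; [M] bounds the entries of [KK], so nothing here depends
   on [h]. *)
pose C := 2 * (1 + `|M| / alphat).
have C_gt0 : 0 < C by rewrite mulr_gt0// ltr_wpDr// divr_ge0// ltW.
exists (4 * CST + 3 * C) => [|h Sh]; first by apply: addr_gt0; exact: mulr_gt0.
have [SZ1 _ SZtrace] := SZ h Sh.
have [HHxih Hphih [g tphih tIE] _ dheat_eq] := dsol h Sh.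
have [Huh _ uhr] := dW h Sh.
have [H1I _ _] := SZ1 _ Hphi; have [H1IE _ _] := SZ1 _ HE.
have [H1phih _ _] := Hphih; have [[H1uh _ _] _] := Huh.
have [g' tIphi tIE'] : same_trace Om GD (I h phi) (I h E).
  by apply: SZtrace => //; exists phiD.
have Dpsi : HphiD Om GD (T h) k (phih h - I h phi).
  split; first by apply: Hphi_sub => //; exact: SZ1.
  have H1a := H1_sub Om oO bO _ _ H1phih H1IE; have H1b := H1_sub Om oO bO _ _ H1I H1IE.
  (* The common traces [g] and [g'] come from different witnesses and need not be equal functions.
     Subtracting [I h E] from both fields makes each trace vanish, and the difference of the two
     results is psi. *)
  have := trace_sub _ _ _ _ _ _ oO mGD H1a H1b
    (trace_sub _ _ _ _ _ _ oO mGD H1phih H1IE tphih tIE)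
    (trace_sub _ _ _ _ _ _ oO mGD H1I H1IE tIphi tIE').
  rewrite opprB addrA subrK (_ : _ \- _ = cst 0)//.
  by apply/funext => x; rewrite /= !subrr.
have H1psi := H1_sub Om oO bO _ _ H1phih H1I.
(* The discrete space is conforming: the same psi is admissible in the continuous temperature
   equation and in the Poincaré inequality. *)
have Dpsi' : H1D Om GD (phih h - I h phi) := conj H1psi (proj2 Dpsi).
have temp := temperature_error Om oO bO D M k0 cgp r emb4_fin mK KM Kd k0_gt0 cgp_gt0
  _ _ _ _ _ Hphi H1phih H1I Hu H1uh (heat_eq _ Dpsi') (dheat_eq _ Dpsi)
  (poincare _ Dpsi') phir (le_trans (ler_wpDr (n10 _) (lexx _)) uhr) small_r.
have uX : norm1 Om (xi.2 - (xih h).2) <= normHH Om (xi - xih h) :=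
  norm1_le_normHH Om (xi - xih h).
have t_ge0 : 0 <= norms Om eps xi.1.1 by exact: sqrtr_ge0.
have d_ge0 : 0 <= distHH Om xi (HHh Om (T h) k) by apply: distHH_ge0; exists (xih h).
have CA_ge0 : 0 <= CA D alphaO.
  by rewrite /CA divr_ge0 ?(ltW alphaO_gt0)// !mulr_ge0 ?sqrtr_ge0.
apply: (absorb_total CST a (norms Om eps xi.1.1) (norm1 Om xi.2) (Chat r) (CA D alphaO) r C
  _ _ _ _ (norm1 Om (xi.2 - (xih h).2))) => //.
- exact: ltW.
- exact: ltW.
- exact: ltW.
- by rewrite mulrA.
- exact: strang.
Qed.
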